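(* Let $\Lambda$ be a Gorenstein artin algebra and let $\mathcal{C}$ be an $n\mathbb{Z}$-cluster tilting subcategory of $\mathrm{mod}\text{-}\Lambda$. Then $n\mathbb{Z}\text{-}\mathrm{Gprj}\text{-}\mathcal{C}$ is an $n$-resolving subcategory of $\mathcal{C}$.
   Context: $n$ is a positive integer, $\Lambda$ is an artin algebra over a commutative artinian ring, $\mathrm{mod}\text{-}\Lambda$ is the category of finitely generated right $\Lambda$-modules, $\mathrm{prj}\text{-}\Lambda$ its full subcategory of projectives. $\Lambda$ is (Iwanaga-)Gorenstein if it has finite injective dimension both as a right and as a left module over itself. A full subcategory $\mathcal{C}$ of $\mathrm{mod}\text{-}\Lambda$ is $n$-cluster tilting if it is functorially finite and $\mathcal{C}=\{X\mid \mathrm{Ext}^i_\Lambda(\mathcal{C},X)=0 \text{ for all } 0<i<n\}=\{X\mid \mathrm{Ext}^i_\Lambda(X,\mathcal{C})=0\text{ for all } 0<i<n\}$. It is $n\mathbb{Z}$-cluster tilting if moreover $\mathrm{Ext}^i_\Lambda(\mathcal{C},\mathcal{C})=0$ for all $i>0$ with $i\notin n\mathbb{Z}$ (equivalently $\Omega^n(\mathcal{C})\subseteq\mathcal{C}$). An acyclic complex $\mathbf{P}:\cdots\to P^{-1}\to P^0\to P^1\to\cdots$ of finitely generated projective $\Lambda$-modules, with $Z^j=\mathrm{Ker}(P^j\to P^{j+1})$, is called $n\mathbb{Z}$-totally acyclic if (i) for every $i\in\mathbb{Z}$ and every projective $\Lambda$-module $Q$, applying $\mathrm{Hom}_\Lambda(-,Q)$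 to the exact sequence $0\to Z^{in}\to P^{in}\to\cdots\to P^{(i+1)n-1}\to Z^{(i+1)n}\to 0$ gives an acyclic complex, and (ii) $Z^{in}\in\mathcal{C}$ for all $i\in\mathbb{Z}$. A module $G\in\mathcal{C}$ is $n\mathbb{Z}$-Gorenstein projective if $G\cong Z^{in}$ for some $i$ and some $n\mathbb{Z}$-totally acyclic complex; $n\mathbb{Z}\text{-}\mathrm{Gprj}\text{-}\mathcal{C}$ is the full subcategory of these modules. An $n$-exact sequence in $\mathcal{C}$ is a complex $0\to X^0\to X^1\to\cdots\to X^{n+1}\to0$ with terms in $\mathcal{C}$ such that for each $C\in\mathcal{C}$ the sequences $0\to\mathrm{Hom}(C,X^0)\to\cdots\to\mathrm{Hom}(C,X^{n+1})$ and $0\to\mathrm{Hom}(X^{n+1},C)\to\cdots\to\mathrm{Hom}(X^0,C)$ are exact; for $\mathcal{C}$ $n$-cluster tilting these are exactly the exact sequences of $\mathrm{mod}\text{-}\Lambda$ of this length with all terms in $\mathcal{C}$. A full subcategory $\mathcal{M}$ of an $n$-cluster tilting subcategory $\mathcal{C}$ of $\mathrm{mod}\text{-}\Lambda$ is $n$-resolving if: (i) $\mathrm{prj}\text{-}\Lambda\subseteq\mathcal{M}$; (ii) for every epimorphism $M\to M'\to 0$ (of $\Lambda$-modules) with $M,M'\in\mathcal{M}$ there is an $n$-exact sequence $0\to M^1\to\cdots\to M^n\to M\to M'\to0$ (ending in the given epimorphism) with all terms in $\mathcal{M}$; (iii) each exact sequence $0\to M'\to A^1\to\cdots\to A^n\to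 M\to0$ in $\mathrm{mod}\text{-}\Lambda$ with $M,M'\in\mathcal{M}$ is Yoneda equivalent (i.e. defines the same class in $\mathrm{Ext}^n_\Lambda(M,M')$) to an $n$-exact sequence $0\to M'\to M^1\to\cdots\to M^n\to M\to 0$ with $M^i\in\mathcal{M}$ for all $i\in\{1,\dots,n\}$. *)

(* Defs.v *)
From HB Require Import structures.
From mathcomp Require Import all_boot all_order all_algebra.
From Stdlib Require Import Relations.Relation_Operators.

Set Implicit Arguments.
Unset Strict Implicit.
Unset Printing Implicit Defensive.

Import GRing.Theory.
Local Open Scope ring_scope.

(* [lmodType A] is the type of left A-modules.  A right L-module is a left
   module over the converse ring L^c, so everything below is developed for left
   modules over an arbitrary ring A and is used with A := L^c.  A full
   subcategory is a predicate on modules. *)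

Section Kernel.
Variables (A : pzRingType) (U V : lmodType A) (f : {linear U -> V}).

Definition ker_pred : {pred U} := fun x => f x == 0.

Lemma ker_pred_submod_closed : submod_closed ker_pred.
Proof.
split=> [|a x y]; rewrite !unfold_in ?raddf0 ?eqxx // => /eqP fx /eqP fy.
by rewrite linearP fx fy scaler0 addr0.
Qed.

HB.instance Definition _ :=
  GRing.isSubmodClosed.Build A U ker_pred ker_pred_submod_closed.

Record kermod := KerMod { ker_incl : U; ker_inclP : ker_incl \in ker_pred }.

HB.instance Definition _ := [isSub for ker_incl].
HB.instance Definition _ := [Choice of kermod by <:].
HB.instance Definition _ := [SubChoice_isSubLmodule of kermod by <:].

Lemma ker_incl_linear : linear ker_incl.
Proof. exact: (GRing.linearP (val : kermod -> U)). Qed.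

HB.instance Definition _ :=
  GRing.isLinear.Build A kermod U *:%R ker_incl ker_incl_linear.

Section Corestriction.
Variables (W : lmodType A) (g : {linear W -> U}).
Hypothesis fg0 : forall x, f (g x) = 0.

Lemma ker_corestr_subproof x : g x \in ker_pred.
Proof. by rewrite unfold_in fg0. Qed.

Definition ker_corestr x : kermod := KerMod (ker_corestr_subproof x).

Lemma ker_corestr_linear : linear ker_corestr.
Proof.
move=> a x y; apply: val_inj; rewrite [LHS]/= linearP.
by rewrite [RHS](GRing.linearP (val : kermod -> U)).
Qed.

HB.instance Definition _ :=
  GRing.isLinear.Build A W kermod *:%R ker_corestr ker_corestr_linear.

End Corestriction.
End Kernel.

Section Modules.
Variable A : pzRingType.
Implicit Types U V W X Y M N Q : lmodType A.

Definition fin_gen M : Prop :=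
  exists (k : nat) (e : 'I_k -> M),
    forall x, exists c : 'I_k -> A, x = \sum_(i < k) c i *: e i.

Definition surjective U V (f : U -> V) : Prop := forall y, exists x, f x = y.

Definition exact_at U V W (f : {linear U -> V}) (g : {linear V -> W}) : Prop :=
  forall y, g y = 0 <-> exists x, f x = y.

Definition isomorphic U V : Prop := exists f : {linear U -> V}, bijective f.

Definition projective Q : Prop :=
  forall U V (p : {linear U -> V}) (f : {linear Q -> V}), surjective p ->
    exists g : {linear Q -> U}, forall x, p (g x) = f x.

Definition injective_module Q : Prop :=
  forall U V (j : {linear U -> V}) (f : {linear U -> Q}), injective j ->
    exists g : {linear V -> Q}, forall x, g (j x) = f x.

Record proj_resolution X := ProjResolution {
  res_ob :> nat -> lmodType A;
  res_d : forall k, {linear res_ob k.+1 -> res_ob k};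
  res_aug : {linear res_ob 0 -> X};
  res_proj : forall k, projective (res_ob k);
  res_aug_surj : surjective res_aug;
  res_exact0 : exact_at (res_d 0) res_aug;
  res_exact : forall k, exact_at (res_d k.+1) (res_d k)
}.

(* [hom_acyclic_at P Y k] says that the k-th cohomology group of Hom(P, Y)
   vanishes. *)
Definition hom_acyclic_at X (P : proj_resolution X) Y (k : nat) : Prop :=
  forall g : {linear P k -> Y}, (forall x, g (res_d P k x) = 0) ->
  match k return {linear P k -> Y} -> Prop with
  | 0 => fun g => forall x, g x = 0
  | l.+1 => fun g => exists h : {linear P l -> Y},
              forall x, g x = h (res_d P l x)
  end g.

(* Ext^k(X, Y) = 0; the cohomology does not depend on the resolution. *)
Definition Ext_vanish (k : nat) X Y : Prop :=
  forall P : proj_resolution X, hom_acyclic_at P Y k.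

Record inj_resolution M := InjResolution {
  cores_ob :> nat -> lmodType A;
  cores_d : forall k, {linear cores_ob k -> cores_ob k.+1};
  cores_aug : {linear M -> cores_ob 0};
  cores_inj : forall k, injective_module (cores_ob k);
  cores_aug_inj : injective cores_aug;
  cores_exact0 : exact_at cores_aug (cores_d 0);
  cores_exact : forall k, exact_at (cores_d k) (cores_d k.+1)
}.

Definition finite_injdim M : Prop :=
  exists (m : nat) (I : inj_resolution M),
    forall k, (m < k)%N -> forall x : I k, x = 0.

(* A finite sequence X^0 -> X^1 -> ... -> X^(n+1).  Only the terms of index at
   most n.+1, and the maps between them, are relevant; n is a parameter of the
   notions below. *)
Record mseq := MSeq {
  sob :> nat -> lmodType A;
  sd : forall k, {linear sob k -> sob k.+1}
}.

Definition exact_seq (n : nat) (S : mseq) : Prop :=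
  [/\ injective (sd S 0),
      forall k, (k < n)%N -> exact_at (sd S k) (sd S k.+1)
    & surjective (sd S n)].

Definition is_complex (n : nat) (S : mseq) : Prop :=
  forall k, (k < n)%N -> forall x, sd S k.+1 (sd S k x) = 0.

(* Exactness of 0 -> Hom(C, S^0) -> ... -> Hom(C, S^(n+1)). *)
Definition hom_from_exact (n : nat) (S : mseq) (C : lmodType A) : Prop :=
  (forall g : {linear C -> S 0}, (forall x, sd S 0 (g x) = 0) ->
     forall x, g x = 0)
  /\ forall k, (k < n)%N -> forall g : {linear C -> S k.+1},
       (forall x, sd S k.+1 (g x) = 0) <->
       (exists h : {linear C -> S k}, forall x, g x = sd S k (h x)).

(* Exactness of 0 -> Hom(S^(n+1), C) -> ... -> Hom(S^0, C). *)
Definition hom_to_exact (n : nat) (S : mseq) (C : lmodType A) : Prop :=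
  (forall g : {linear S n.+1 -> C}, (forall x, g (sd S n x) = 0) ->
     forall x, g x = 0)
  /\ forall k, (k < n)%N -> forall g : {linear S k.+1 -> C},
       (forall x, g (sd S k x) = 0) <->
       (exists h : {linear S k.+2 -> C}, forall x, g x = h (sd S k.+1 x)).

(* Exactness of 0 -> Hom(S^(n+1), C) -> ... -> Hom(S^0, C) -> 0. *)
Definition hom_to_acyclic (n : nat) (S : mseq) (C : lmodType A) : Prop :=
  hom_to_exact n S C /\
  forall g : {linear S 0 -> C}, exists h : {linear S 1 -> C},
    forall x, g x = h (sd S 0 x).

Definition n_exact (n : nat) (C : lmodType A -> Prop) (S : mseq) : Prop :=
  [/\ forall k, (k <= n.+1)%N -> C (S k),
      is_complex n S,
      forall D, C D -> hom_from_exact n S D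
    & forall D, C D -> hom_to_exact n S D].

(* An exact sequence 0 -> L -> E^1 -> ... -> E^n -> M -> 0; the outer terms of
   the underlying sequence are identified with L and M by specified
   isomorphisms. *)
Record extension (n : nat) (L M : lmodType A) := Extension {
  ext_seq :> mseq;
  ext_fg : forall k, (k <= n.+1)%N -> fin_gen (ext_seq k);
  ext_exact : exact_seq n ext_seq;
  ext_l : {linear L -> ext_seq 0};
  ext_l_bij : bijective ext_l;
  ext_r : {linear ext_seq n.+1 -> M};
  ext_r_bij : bijective ext_r
}.

Definition ext_morphism n L M (E F : extension n L M) : Prop :=
  exists h : forall k, {linear E k -> F k},
    [/\ forall k, (k <= n)%N -> forall x, h k.+1 (sd E k x) = sd F k (h k x),
        forall x, h 0 (ext_l E x) = ext_l F x
      & forall x, ext_r F (h n.+1 x) = ext_r E x].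

(* E and F have the same class in Ext^n(M, L). *)
Definition yoneda_equiv n L M (E F : extension n L M) : Prop :=
  clos_refl_sym_trans (extension n L M) (@ext_morphism n L M) E F.

Definition right_approx (C : lmodType A -> Prop) X : Prop :=
  exists (D : lmodType A) (f : {linear D -> X}), C D /\
    forall (D' : lmodType A) (g : {linear D' -> X}), C D' ->
      exists h : {linear D' -> D}, forall x, g x = f (h x).

Definition left_approx (C : lmodType A -> Prop) X : Prop :=
  exists (D : lmodType A) (f : {linear X -> D}), C D /\
    forall (D' : lmodType A) (g : {linear X -> D'}), C D' ->
      exists h : {linear D -> D'}, forall x, g x = h (f x).

Definition functorially_finite (C : lmodType A -> Prop) : Prop :=
  forall X, fin_gen X -> right_approx C X /\ left_approx C X.

Definition cluster_tilting (n : nat) (C : lmodType A -> Prop) : Prop :=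
  [/\ functorially_finite C,
      forall X, C X <-> fin_gen X /\
        forall i Y, (0 < i < n)%N -> C Y -> Ext_vanish i Y X
    & forall X, C X <-> fin_gen X /\
        forall i Y, (0 < i < n)%N -> C Y -> Ext_vanish i X Y].

Definition nZ_cluster_tilting (n : nat) (C : lmodType A -> Prop) : Prop :=
  cluster_tilting n C /\
  forall i X Y, (0 < i)%N -> ~~ (n %| i)%N -> C X -> C Y -> Ext_vanish i X Y.

Record fgproj_acyclic_complex := FgprojAcyclicComplex {
  cob :> int -> lmodType A;
  cd : forall j : int, {linear cob j -> cob (j + 1)};
  cob_fg : forall j, fin_gen (cob j);
  cob_proj : forall j, projective (cob j);
  cd_exact : forall j, exact_at (cd j) (cd (j + 1))
}.

Section Segment.
Variable P : fgproj_acyclic_complex.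

Definition cycle (j : int) : lmodType A := kermod (cd P j).

Lemma cdd0 j x : cd P (j + 1) (cd P j x) = 0.
Proof. by apply/cd_exact; exists x. Qed.

Definition to_cycle (j : int) : {linear P j -> cycle (j + 1)} :=
  ker_corestr (@cdd0 j).

(* The segment 0 -> Z^a -> P^a -> ... -> P^(a+n-1) -> Z^(a+n) -> 0 (for n > 0).
   The index a + k is written [shift a k], so that [shift a k.+1] is
   convertible to [shift a k + 1]. *)
Definition shift (a : int) (k : nat) : int := iter k (fun j => j + 1) a.

Definition seg_term (inner : bool) (j : int) : lmodType A :=
  if inner then P j else cycle j.

Definition seg_head (inner : bool) (j : int) :
    {linear cycle j -> seg_term inner j} :=
  match inner with
  | true => @ker_incl A (P j) (P (j + 1)) (cd P j)
  | false => idfun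
  end.

Definition seg_step (inner inner' : bool) (j : int) :
    {linear seg_term inner j -> seg_term inner' (j + 1)} :=
  match inner, inner' with
  | true, true => cd P j
  | true, false => to_cycle j
  | false, _ => \0
  end.

Definition seg_ob (n : nat) (a : int) (k : nat) : lmodType A :=
  match k with
  | 0 => cycle a
  | l.+1 => seg_term (l < n)%N (shift a l)
  end.

Definition seg_d (n : nat) (a : int) (k : nat) :
    {linear seg_ob n a k -> seg_ob n a k.+1} :=
  match k with
  | 0 => seg_head (0 < n)%N a
  | l.+1 => seg_step (l < n)%N (l.+1 < n)%N (shift a l)
  end.

Definition segment (n : nat) (a : int) : mseq := MSeq (seg_d n a).

End Segment.

Definition nZ_totally_acyclic (n : nat) (C : lmodType A -> Prop)
    (P : fgproj_acyclic_complex) : Prop :=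
  (forall (i : int) Q, projective Q ->
     hom_to_acyclic n (segment P n (i * n%:Z)) Q)
  /\ forall i : int, C (cycle P (i * n%:Z)).

Definition nZ_Gprj (n : nat) (C : lmodType A -> Prop) (G : lmodType A) : Prop :=
  C G /\ exists (P : fgproj_acyclic_complex) (i : int),
    nZ_totally_acyclic n C P /\ isomorphic G (cycle P (i * n%:Z)).

Definition n_resolving (n : nat) (C M : lmodType A -> Prop) : Prop :=
  [/\ forall X, M X -> C X,
      forall X, fin_gen X -> projective X -> M X,
      forall X Y (f : {linear X -> Y}), M X -> M Y -> surjective f ->
        exists S : mseq,
          [/\ n_exact n C S,
              forall k, (k <= n.+1)%N -> M (S k)
            & exists (p : {linear S n -> X}) (q : {linear S n.+1 -> Y}),
                [/\ bijective p, bijective q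
                  & forall x, q (sd S n x) = f (p x)]]
    & forall X Y, M X -> M Y -> forall E : extension n Y X,
        exists F : extension n Y X,
          [/\ n_exact n C F,
              forall k, (0 < k <= n)%N -> M (F k)
            & yoneda_equiv E F]].

End Modules.

Definition is_ideal (R : comPzRingType) (I : R -> Prop) : Prop :=
  [/\ I 0, forall x y, I x -> I y -> I (x + y) & forall a x, I x -> I (a * x)].

Definition artinian (R : comPzRingType) : Prop :=
  forall I : nat -> R -> Prop,
    (forall k, is_ideal (I k)) -> (forall k x, I k.+1 x -> I k x) ->
    exists m, forall k, (m <= k)%N -> forall x, I m x -> I k x.

Definition artin_algebra (R : comPzRingType) (L : algType R) : Prop :=
  artinian R /\ fin_gen L.

(* [L^c^o] is L as a right module over itself, [L^o] as a left module. *)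
Definition gorenstein (L : pzRingType) : Prop :=
  finite_injdim (L^c^o : lmodType L^c) /\ finite_injdim (L^o : lmodType L).

(* Main.v *)
From HB Require Import structures.
From mathcomp Require Import all_boot all_order all_algebra.
From mathcomp.multinomials Require Import freeg.
From Stdlib Require Import ClassicalEpsilon Relations.Relation_Operators.
Require Import Defs.

Set Implicit Arguments.
Unset Strict Implicit.
Unset Printing Implicit Defensive.

Import GRing.Theory.
Local Open Scope ring_scope.

(* Over a Gorenstein algebra the nZ-Gorenstein projectives of C are exactly the
   modules of C that are Gorenstein projective, i.e. satisfy Ext^(>0)(M, A) = 0:
   a complete resolution of such an M exists because both self-injective
   dimensions are finite, and if one cycle lies in C then so do the cycles n steps
   away, since Ext^i(Z, Y) = Ext^(i+n)(Z, Omega^n Y) = Ext^i(Omega^n Z, Omega^n Y)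
   for Z Gorenstein projective and Omega^n preserves C.

   The key point is that every Gorenstein projective K has a resolution of length
   n by such modules. Take a cosyzygy K' of K, N steps away with N a large multiple
   of n, resolve K' by n modules of C, and take N-th syzygies of the whole
   resolution: the terms stay in C and become Gorenstein projective.
   Applied to kernels, this gives the n-exact sequences ending in a given
   epimorphism. For an extension of X by Y with complete coresolution
   0 -> Y -> Q^1 -> ... -> Q^n -> Z -> 0, the class is given by a map X -> Z; a
   resolution of the kernel of X (+) F -> Z, with F projective, is combined with the
   Q^i by the horseshoe lemma and pulled back along X -> X (+) F. *)


(** * Linear maps, short exact sequences and pullbacks *)

(** The definitions range over all modules, not only the finitely generated ones. Ext is tested on
    arbitrary projective resolutions, so free modules on arbitrary sets are used, and vanishing of
    Ext is recast as a recursive lifting condition from which the needed parts of the long exact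
    sequences follow without Ext groups. Finite generation of kernels has to be extracted from the
    artinian base ring, through the fact that such a ring is noetherian.

    The two injective dimensions enter differently. That of the algebra as a right module makes all
    deep syzygies Gorenstein projective; that as a left module shows, by duality, that a Gorenstein
    projective module embeds in a free one, which yields cosyzygies.

    A resolution of K by modules of C always exists, but its terms need not be Gorenstein
    projective. Deep syzygies repair the terms and replace the resolved module by its syzygy, hence
    the preliminary passage to a cosyzygy. The summand F makes the map to Z surjective, so that its
    kernel is Gorenstein projective and can be resolved. *)

Section LinearMaps.
Variable A : pzRingType.
Implicit Types U V W X Y M N K B P Q : lmodType A.

Definition mklin U V (f : U -> V) (lf : linear f) : {linear U -> V} :=
  HB.pack f (GRing.isLinear.Build A U V *:%R f lf).

Lemma lin_subE U V (f g : {linear U -> V}) x :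
  (f \- g : {linear U -> V}) x = f x - g x.
Proof. by []. Qed.

Lemma lin_addE U V (f g : {linear U -> V}) x :
  (f \+ g : {linear U -> V}) x = f x + g x.
Proof. by []. Qed.

Lemma lin_compE U V W (f : {linear V -> W}) (g : {linear U -> V}) x :
  (f \o g : {linear U -> W}) x = f (g x).
Proof. by []. Qed.

Definition linE := (lin_subE, lin_addE, lin_compE).

(** Modules are choice types with decidable equality, so a set-theoretic section is obtained without
    any axiom. *)
Lemma surj_section U V (p : U -> V) : surjective p ->
  exists q : V -> U, cancel q p.
Proof.
move=> sp; have sp' y : exists x, p x == y by case: (sp y) => x <-; exists x.
by exists (fun y => xchoose (sp' y)) => y; apply/eqP/(xchooseP (sp' y)).
Qed.

Lemma factor_surj U V W (p : {linear U -> V}) (g : {linear U -> W}) :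
  surjective p -> (forall x, p x = 0 -> g x = 0) ->
  exists h : {linear V -> W}, forall x, h (p x) = g x.
Proof.
move=> sp pg; have [q qK] := surj_section sp.
have E x y : p x = p y -> g x = g y.
  by move=> e; apply/subr0_eq; rewrite -linearB pg // linearB e subrr.
have lh : linear (g \o q).
  move=> a x y /=; rewrite -linearP; apply: E.
  by rewrite linearP !qK.
by exists (mklin lh) => x /=; apply: E; rewrite qK.
Qed.

Lemma factor_inj U V W (i : {linear U -> V}) (g : {linear W -> V}) :
  injective i -> (forall w, exists u, i u = g w) ->
  exists h : {linear W -> U}, forall w, i (h w) = g w.
Proof.
move=> ii ig; have ig' w : exists u, i u == g w.
  by case: (ig w) => u e; exists u; rewrite e.
pose h w := xchoose (ig' w); have hE w : i (h w) = g w.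
  exact/eqP/(xchooseP (ig' w)).
have lh : linear h by move=> a x y; apply: ii; rewrite linearP !hE linearP.
by exists (mklin lh).
Qed.

Lemma bij_linv U V (f : {linear U -> V}) : bijective f ->
  exists g : {linear V -> U}, cancel f g /\ cancel g f.
Proof.
move=> bf; have [h] := @factor_inj U V V f idfun (bij_inj bf)
  (let: Bijective g fK gK := bf in fun w => ex_intro _ (g w) (gK w)).
by move=> hK; exists h; split=> // x; apply: (bij_inj bf); rewrite hK.
Qed.

Lemma bij_surj U V (f : U -> V) : bijective f -> surjective f.
Proof. by case=> g _ gK y; exists (g y). Qed.

Lemma inj_surj_bij U V (f : {linear U -> V}) :
  injective f -> surjective f -> bijective f.
Proof.
by move=> fi /surj_section[g gK]; exists g => // x; apply: fi; rewrite gK.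
Qed.

Definition ses K B W (i : {linear K -> B}) (p : {linear B -> W}) : Prop :=
  [/\ injective i, exact_at i p & surjective p].

Lemma ses_comp0 K B W (i : {linear K -> B}) (p : {linear B -> W}) x :
  ses i p -> p (i x) = 0.
Proof. by case=> _ e _; apply/e; exists x. Qed.

Lemma ker_incl_inj U V (f : {linear U -> V}) : injective (@ker_incl A U V f).
Proof. exact: val_inj. Qed.

Lemma ker_incl0 U V (f : {linear U -> V}) x : f (@ker_incl A U V f x) = 0.
Proof. by case: x => x /= /eqP. Qed.

Lemma ker_incl_exact U V (f : {linear U -> V}) :
  exact_at (@ker_incl A U V f) f.
Proof.
move=> x; split=> [fx|[y <-]]; last exact: ker_incl0.
have kx : x \in ker_pred f by rewrite unfold_in fx.
by exists (KerMod kx).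
Qed.

Lemma ses_ker U V (f : {linear U -> V}) : surjective f ->
  ses (@ker_incl A U V f) f.
Proof.
by move=> sf; split=> //; [exact: ker_incl_inj | exact: ker_incl_exact].
Qed.

Lemma exact_factor K B W X (i : {linear K -> B}) (p : {linear B -> W})
    (g : {linear X -> B}) : injective i -> exact_at i p ->
  (forall x, p (g x) = 0) -> exists h : {linear X -> K}, forall x, i (h x) = g x.
Proof. by move=> ii ip pg; apply: factor_inj => // w; apply/ip. Qed.

Lemma exact_cofactor K B W Y (i : {linear K -> B}) (p : {linear B -> W})
    (g : {linear B -> Y}) : exact_at i p -> surjective p ->
  (forall x, g (i x) = 0) -> exists h : {linear W -> Y}, forall x, h (p x) = g x.
Proof. by move=> ip sp gi; apply: factor_surj => // x /ip[y <-]. Qed.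

Lemma ses_bijr K B W W' (i : {linear K -> B}) (p : {linear B -> W})
    (f : {linear W -> W'}) : ses i p -> bijective f -> ses i (f \o p).
Proof.
move=> [ii ip sp] bf; split=> //.
- move=> y /=; rewrite -ip; split=> [|->]; last by rewrite linear0.
  by rewrite -[X in f _ = X](linear0 f) => /(bij_inj bf).
- move=> y; have [w <-] := bij_surj bf y; have [x <-] := sp w.
  by exists x.
Qed.

Lemma ses_bijl K K' B W (i : {linear K -> B}) (p : {linear B -> W})
    (f : {linear K' -> K}) : ses i p -> bijective f -> ses (i \o f) p.
Proof.
move=> [ii ip sp] bf; split=> //; first exact: (inj_comp ii (bij_inj bf)).
move=> y /=; rewrite ip; split=> [[x <-]|[x <-]]; last by exists (f x).
by have [z <-] := bij_surj bf x; exists z.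
Qed.

Section Pullback.
Variables (B K W : lmodType A) (p : {linear B -> W}) (u : {linear K -> W}).

Definition pb_diff : {linear (B * K)%type -> W} := (p \o fst) \- (u \o snd).

Definition pullback : lmodType A := kermod pb_diff.

(* Opaque, lest rewriting with [linE] see through the projections. *)
Fact pb_fst_spec :
  {f : {linear pullback -> B} | forall x, f x = (ker_incl x).1}.
Proof. by exists (fst \o @ker_incl A _ _ pb_diff). Qed.
Fact pb_snd_spec :
  {f : {linear pullback -> K} | forall x, f x = (ker_incl x).2}.
Proof. by exists (snd \o @ker_incl A _ _ pb_diff). Qed.

Definition pb_fst := sval pb_fst_spec.
Definition pb_snd := sval pb_snd_spec.

Lemma pb_fstE x : pb_fst x = (ker_incl x).1.
Proof. exact: svalP pb_fst_spec x. Qed.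
Lemma pb_sndE x : pb_snd x = (ker_incl x).2.
Proof. exact: svalP pb_snd_spec x. Qed.

Lemma pb_comm x : p (pb_fst x) = u (pb_snd x).
Proof. by rewrite pb_fstE pb_sndE; apply/subr0_eq; apply: (ker_incl0 x). Qed.

Lemma pb_inj x y : pb_fst x = pb_fst y -> pb_snd x = pb_snd y -> x = y.
Proof.
rewrite !pb_fstE !pb_sndE => e1 e2; apply: ker_incl_inj.
by move: e1 e2; case: (ker_incl x) (ker_incl y) => [? ?] [? ?] /= -> ->.
Qed.

Lemma pb_elt b k : p b = u k -> exists x, pb_fst x = b /\ pb_snd x = k.
Proof.
move=> e; have /(ker_incl_exact pb_diff)[x ex] : pb_diff (b, k) = 0.
  by rewrite /pb_diff /= /GRing.sub_fun /= e subrr.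
by exists x; rewrite pb_fstE pb_sndE ex.
Qed.

Lemma pb_lift X (f : {linear X -> B}) (g : {linear X -> K}) :
  (forall x, p (f x) = u (g x)) ->
  exists h : {linear X -> pullback},
    (forall x, pb_fst (h x) = f x) /\ (forall x, pb_snd (h x) = g x).
Proof.
move=> e; have lfg : linear (fun x => (f x, g x)).
  by move=> a x y; rewrite !linearP.
have [w|h hE] := @exact_factor _ _ _ X _ pb_diff (mklin lfg)
  (@ker_incl_inj _ _ pb_diff) (@ker_incl_exact _ _ pb_diff).
  by rewrite /pb_diff /= /GRing.sub_fun /= e subrr.
by exists h; split=> x; rewrite ?pb_fstE ?pb_sndE hE.
Qed.

Lemma pb_snd_surj : surjective p -> surjective pb_snd.
Proof. by move=> sp k; have [b /pb_elt[x [_ <-]]] := sp (u k); exists x. Qed.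

Lemma pb_fst_surj : surjective u -> surjective pb_fst.
Proof. by move=> su b; have [k /esym/pb_elt[x [<- _]]] := su (p b); exists x. Qed.

Lemma pb_ses_snd Y (i : {linear Y -> B}) : ses i p ->
  exists j : {linear Y -> pullback}, ses j pb_snd /\ forall y, pb_fst (j y) = i y.
Proof.
move=> si; have [ii ip sp] := si.
have [y|j [j1 j2]] := @pb_lift Y i \0; first by rewrite linear0 (ses_comp0 _ si).
exists j; split=> //; split; last exact: pb_snd_surj.
- by move=> x y e; apply: ii; rewrite -!j1 e.
- move=> x; split=> [x2|[y <-]]; last by rewrite j2.
  have /ip[y iy] : p (pb_fst x) = 0 by rewrite pb_comm x2 linear0.
  by exists y; apply: pb_inj; rewrite ?j1 ?j2.
Qed.

Lemma pb_ses_fst Y (i : {linear Y -> K}) : ses i u ->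
  exists j : {linear Y -> pullback}, ses j pb_fst /\ forall y, pb_snd (j y) = i y.
Proof.
move=> si; have [ii ip sp] := si.
have [y|j [j1 j2]] := @pb_lift Y \0 i; first by rewrite linear0 (ses_comp0 _ si).
exists j; split=> //; split; last exact: pb_fst_surj.
- by move=> x y e; apply: ii; rewrite -!j2 e.
- move=> x; split=> [x2|[y <-]]; last by rewrite j1.
  have /ip[y iy] : u (pb_snd x) = 0 by rewrite -pb_comm x2 linear0.
  by exists y; apply: pb_inj; rewrite ?j1 ?j2.
Qed.

End Pullback.

Definition zmod : lmodType A := 'rV[A]_0.

Lemma zmodE (x : zmod) : x = 0. Proof. exact: thinmx0. Qed.

Lemma projective_zmod : projective zmod.
Proof.
by move=> U V p f _; exists \0 => x; rewrite (zmodE x) !linear0.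
Qed.

Lemma ses_zmodl U V (f : {linear U -> V}) :
  bijective f -> ses (\0 : {linear zmod -> U}) f.
Proof.
move=> bf; split; last exact: bij_surj.
- by move=> x y _; rewrite (zmodE x) (zmodE y).
- move=> y; split=> [|[x <-]]; last by rewrite linear0.
  by rewrite -[X in _ = X](linear0 f) => /(bij_inj bf) ->; exists 0.
Qed.

Lemma ses0_bij K B W (i : {linear K -> B}) (p : {linear B -> W}) :
  ses i p -> (forall x : K, x = 0) -> bijective p.
Proof.
move=> [ii ip sp] K0; apply: inj_surj_bij => //; apply: raddf_inj => x /ip[k <-].
by rewrite (K0 k) linear0.
Qed.

Lemma projective_prod P Q : projective P -> projective Q ->
  projective (P * Q)%type.
Proof.
move=> pP pQ U V p f sp.
have l1 : linear (fun x : P => (x, 0) : (P * Q)%type).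
  by move=> a x y; apply: injective_projections; rewrite /= ?scaler0 ?addr0.
have l2 : linear (fun x : Q => (0, x) : (P * Q)%type).
  by move=> a x y; apply: injective_projections; rewrite /= ?scaler0 ?addr0.
have [g gE] := pP U V p (f \o mklin l1) sp.
have [h hE] := pQ U V p (f \o mklin l2) sp.
exists ((g \o fst) \+ (h \o snd)) => -[x y].
rewrite /= /GRing.add_fun /= linearD gE hE /= -linearD; congr (f _).
by apply: injective_projections; rewrite /= ?addr0 ?add0r.
Qed.

Lemma projective_retract P Q (s : {linear P -> Q}) (r : {linear Q -> P}) :
  cancel s r -> projective Q -> projective P.
Proof.
move=> sK pQ U V p f sp; have [g gE] := pQ U V p (f \o r) sp.
by exists (g \o s) => x; rewrite /= gE /= sK.
Qed.

Lemma ses_proj_retract K B Q (i : {linear K -> B}) (p : {linear B -> Q}) :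
  ses i p -> projective Q -> exists r : {linear B -> K}, cancel i r.
Proof.
move=> si pQ; have [ii ip sp] := si; have [s sE] := pQ _ _ p idfun sp.
have [|r rE] := @exact_factor K B Q B i p (idfun \- (s \o p)) ii ip.
  by move=> x; rewrite /= /GRing.sub_fun /= linearB sE subrr.
exists r => x; apply: ii; rewrite rE /= /GRing.sub_fun /=.
by rewrite (ses_comp0 _ si) linear0 subr0.
Qed.

Lemma projective_ker K B Q (i : {linear K -> B}) (p : {linear B -> Q}) :
  ses i p -> projective Q -> projective B -> projective K.
Proof.
by move=> si pQ pB; have [r rK] := ses_proj_retract si pQ; apply: projective_retract rK pB.
Qed.

Definition row_comb k U (e : 'I_k -> U) (c : 'rV[A]_k) : U :=
  \sum_(i < k) c 0 i *: e i.

Lemma row_comb_linear k U (e : 'I_k -> U) : linear (row_comb e).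
Proof.
move=> a x y; rewrite /row_comb scaler_sumr -big_split; apply: eq_bigr => i _.
by rewrite !mxE scalerDl scalerA.
Qed.

Definition row_lin k U (e : 'I_k -> U) : {linear 'rV[A]_k -> U} :=
  mklin (row_comb_linear e).

Lemma row_linE k U (f : {linear 'rV[A]_k -> U}) x :
  f x = \sum_(i < k) x 0 i *: f (delta_mx 0 i).
Proof.
by rewrite {1}(row_sum_delta x) linear_sum; apply: eq_bigr => i _; rewrite linearZ.
Qed.

Lemma fin_gen_row k : fin_gen 'rV[A]_k.
Proof.
by exists k, (delta_mx 0) => x; exists (x 0); rewrite {1}(row_sum_delta x).
Qed.

Lemma projective_row k : projective 'rV[A]_k.
Proof.
move=> U V p f sp; have [q qK] := surj_section sp.
exists (row_lin (fun i => q (f (delta_mx 0 i)))) => x.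
rewrite /= /row_comb linear_sum row_linE; apply: eq_bigr => i _.
by rewrite linearZ qK.
Qed.

Lemma fin_gen_surj U V (p : {linear U -> V}) :
  surjective p -> fin_gen U -> fin_gen V.
Proof.
move=> sp [k [e eP]]; exists k, (p \o e) => y; have [x <-] := sp y.
have [c ->] := eP x; exists c; rewrite linear_sum; apply: eq_bigr => i _.
by rewrite linearZ.
Qed.

Lemma fin_genP U : fin_gen U <->
  exists (k : nat) (p : {linear 'rV[A]_k -> U}), surjective p.
Proof.
split=> [[k [e eP]]|[k [p sp]]]; last exact: fin_gen_surj sp (fin_gen_row k).
exists k, (row_lin e) => x; have [c ->] := eP x; exists (\row_i c i).
by apply: eq_bigr => i _; rewrite mxE.
Qed.

Lemma fin_gen_prod U V : fin_gen U -> fin_gen V -> fin_gen (U * V)%type.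
Proof.
move=> /fin_genP[k [p sp]] /fin_genP[l [q sq]]; apply/fin_genP; exists (k + l)%N.
have lpq : linear (fun x : 'rV[A]_(k + l) => (p (lsubmx x), q (rsubmx x))).
  by move=> a x y; rewrite !linearP.
exists (mklin lpq) => -[x y]; have [c cE] := sp x; have [d dE] := sq y.
by exists (row_mx c d); rewrite /= row_mxKl row_mxKr cE dE.
Qed.

Lemma fin_gen_zmod : fin_gen zmod. Proof. exact: fin_gen_row. Qed.

Lemma fin_gen_bij U V (f : {linear U -> V}) : bijective f -> fin_gen U -> fin_gen V.
Proof. by move/bij_surj; apply: fin_gen_surj. Qed.

Lemma fin_gen_bijr U V (f : {linear U -> V}) : bijective f -> fin_gen V -> fin_gen U.
Proof. by move=> /bij_linv[g [fK gK]]; apply: (@fin_gen_bij _ _ g); exists f. Qed.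

Lemma fin_gen_ext K B W (i : {linear K -> B}) (p : {linear B -> W}) :
  ses i p -> fin_gen K -> fin_gen W -> fin_gen B.
Proof.
move=> [ii ip sp] fK /fin_genP[k [q sq]].
have [u uE] := projective_row q sp.
apply: (@fin_gen_surj (K * 'rV[A]_k)%type B ((i \o fst) \+ (u \o snd))).
  move=> b; have [c cE] := sq (p b).
  have /ip[x xE] : p (b - u c) = 0 by rewrite linearB uE cE subrr.
  by exists (x, c); rewrite /= /GRing.add_fun /= xE subrK.
exact: fin_gen_prod fK (fin_gen_row k).
Qed.

End LinearMaps.

(** * Free modules on arbitrary sets *)

Section Free.
Variable A : nzRingType.

HB.instance Definition _ (M : lmodType A) (K : choiceType) (e : K -> M) :=
  GRing.isZmodMorphism.Build {freeg K / A} M (fglift e) (lift_is_additive e).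

Lemma fglift_sum (M : lmodType A) (K : choiceType) (e : K -> M) (D : {freeg K / A}) :
  fglift e D = \sum_(z <- dom D) coeff z D *: e z.
Proof.
rewrite -{1}(freeg_sumE D) raddf_sum; apply: eq_bigr => z _.
exact: liftU.
Qed.

Lemma fglift_linear (M : lmodType A) (K : choiceType) (e : K -> M) :
  linear (fglift e : {freeg K / A} -> M).
Proof.
move=> a x y; rewrite raddfD; congr (_ + _).
have -> : a *: x = \sum_(z <- dom x) << a * coeff z x *g z >> by [].
rewrite raddf_sum fglift_sum scaler_sumr; apply: eq_bigr => z _.
by rewrite scalerA; apply: liftU.
Qed.

Definition free_lin (M : lmodType A) (K : choiceType) (e : K -> M) :
  {linear {freeg K / A} -> M} := mklin (fglift_linear e).

Lemma projective_freeg (K : choiceType) : projective {freeg K / A}.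
Proof.
move=> U V p f sp; have [q qK] := surj_section sp.
exists (free_lin (fun x => q (f << x >>))) => D.
rewrite /= fglift_sum linear_sum -[in RHS](freeg_sumE D) linear_sum.
apply: eq_bigr => z _; rewrite linearZ qK /= -linearZ; congr (f _).
apply/eqP/freeg_eqP => x; rewrite coeffZ !coeffU mul1r.
done.
Qed.

Lemma free_cover (M : lmodType A) :
  exists (F : lmodType A) (p : {linear F -> M}), projective F /\ surjective p.
Proof.
exists {freeg M / A}, (free_lin (id : M -> M)); split; first exact: projective_freeg.
by move=> x; exists << x >>; rewrite /= liftU scale1r.
Qed.

End Free.


(** * Vanishing of Ext *)

Section Ext.
Variable A : nzRingType.
Implicit Types B C D E F K M Q R T U V W X Y Z : lmodType A.

(** Ext^1(X, Y) = 0, in the form that every pushout to [Y] of an extension of [X] splits. The middle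
    term [B] is arbitrary; by [ext0_cover] a single projective [B] suffices as a test. *)
Definition ext0 X Y : Prop :=
  forall K B (i : {linear K -> B}) (p : {linear B -> X}), ses i p ->
  forall g : {linear K -> Y}, exists h : {linear B -> Y}, forall x, h (i x) = g x.

(* Beware of the shift: [ext k X Y] says that Ext^(k+1)(X, Y) = 0. *)
Fixpoint ext (k : nat) X Y : Prop :=
  match k with
  | 0 => ext0 X Y
  | l.+1 => forall K Q (i : {linear K -> Q}) (p : {linear Q -> X}),
      projective Q -> ses i p -> ext l K Y
  end.

(** This is exactness of Hom(B, Y) -> Hom(C, Y) -> Ext^1(D, Y) -> Ext^1(B, Y). The pullback of [q]
    and [p] is both an extension of [B] by [K] and one of [E] by [C]. Extend [g] to it, and subtract
    an extension to [B] of the restriction to [C]; the difference descends to [E]. *)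
Lemma ext0_ext Y C B D (i : {linear C -> B}) (p : {linear B -> D}) :
  ses i p -> (forall g : {linear C -> Y}, exists h : {linear B -> Y},
                forall x, h (i x) = g x) -> ext0 B Y -> ext0 D Y.
Proof.
move=> si eY eB K E j q sj g.
have [k [sk kE]] := pb_ses_snd p sj.
have [l [sl lE]] := pb_ses_fst q si.
have [t tE] := eB _ _ k _ sk g.
have [h hE] := eY (t \o l).
have [_ le sl'] := sl.
have [|e eE] := @exact_cofactor A _ _ _ Y l _ (t \- (h \o pb_snd q p)) le sl'.
  by move=> x; rewrite !linE lE hE !linE subrr.
exists e => x; rewrite -kE eE !linE tE.
by rewrite (ses_comp0 x sk) linear0 subr0.
Qed.

Lemma ext0_proj Q Y : projective Q -> ext0 Q Y.
Proof.
move=> pQ K B i p si g; have [r rK] := ses_proj_retract si pQ.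
by exists (g \o r) => x; rewrite /= rK.
Qed.

Lemma ext_proj k Q Y : projective Q -> ext k Q Y.
Proof.
elim: k Q => [|k IH] Q pQ; first exact: ext0_proj.
by move=> K R i p pR si; apply: IH; apply: projective_ker si pQ pR.
Qed.

(* For an epimorphism [q] onto the middle term [B] of a short exact sequence
   0 -> C -> B -> D -> 0, the kernels of [q] and [p \o q] are the first two
   terms of a short exact sequence ending in [C]; this rotation turns the
   long exact sequence of Ext into an induction. *)
Lemma ses_rotate C B D E K (i : {linear C -> B}) (p : {linear B -> D})
    (j : {linear K -> E}) (q : {linear E -> B}) : ses i p -> ses j q ->
  exists (M : lmodType A) (m : {linear M -> E}) (k : {linear K -> M})
         (a : {linear M -> C}),
    [/\ ses m (p \o q), ses k a & forall x, m (k x) = j x].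
Proof.
move=> si sj; have [ii ip sp] := si; have [ij jq sq] := sj.
pose m := @ker_incl A _ _ (p \o q).
have sm : ses m (p \o q).
  by apply: ses_ker => d; have [b <-] := sp d; have [e <-] := sq b; exists e.
have [im mpq _] := sm.
have [|a aE] := @exact_factor A _ _ _ _ i p (q \o m) ii ip.
  by move=> x; apply: (ses_comp0 x sm).
have [|k kE] := @exact_factor A _ _ _ _ m (p \o q) j im mpq.
  by move=> x; rewrite /= (ses_comp0 x sj) linear0.
exists (kermod (p \o q)), m, k, a; split=> //; split.
- by move=> x y e; apply: ij; rewrite -!kE e.
- move=> y; split=> [ay|[x <-]].
    have /jq[x xE] : q (m y) = 0 by rewrite -[q _]aE ay linear0.
    by exists x; apply: im; rewrite kE.
  by apply: ii; rewrite aE /= kE (ses_comp0 _ sj) linear0.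
- move=> x; have [e eE] := sq (i x).
  have /mpq[y yE] : (p \o q) e = 0 by rewrite /= eE (ses_comp0 _ si).
  by exists y; apply: ii; rewrite aE /= yE.
Qed.

Lemma cover_ses X : exists (K Q : lmodType A) (i : {linear K -> Q})
  (p : {linear Q -> X}), projective Q /\ ses i p.
Proof.
have [F [p [pF sp]]] := free_cover X.
by exists (kermod p), F, (@ker_incl A _ _ p), p; split=> //; apply: ses_ker.
Qed.

Definition ext_mid_at k Y := forall C B D (i : {linear C -> B})
  (p : {linear B -> D}), ses i p -> ext k C Y -> ext k D Y -> ext k B Y.
Definition ext_left_at k Y := forall C B D (i : {linear C -> B})
  (p : {linear B -> D}), ses i p -> ext k B Y -> ext k.+1 D Y -> ext k C Y.

(** Schanuel's argument: the pullback of [p] and [p'] is an extension of [Q] by [K'] and also of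
    [Q'] by [K]. *)
Lemma ext_indep_at k Y X K Q K' Q' (i : {linear K -> Q}) (p : {linear Q -> X})
    (i' : {linear K' -> Q'}) (p' : {linear Q' -> X}) :
  ext_mid_at k Y -> ext_left_at k Y ->
  ses i p -> ses i' p' -> projective Q -> projective Q' ->
  ext k K' Y -> ext k K Y.
Proof.
move=> Vm Vl si si' pQ pQ' eK'.
have [j [sj _]] := pb_ses_snd p' si; have [j' [sj' _]] := pb_ses_fst p si'.
apply: Vl sj _ (ext_proj _ _ pQ').
exact: Vm sj' eK' (ext_proj _ _ pQ).
Qed.

Lemma ext_right_at k Y : ext_mid_at k Y -> ext_left_at k Y ->
  forall C B D (i : {linear C -> B}) (p : {linear B -> D}), ses i p ->
  ext k C Y -> ext k.+1 B Y -> ext k.+1 D Y.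
Proof.
move=> Vm Vl C B D i p si eC eB.
have [K [R [j [q [pR sj]]]]] := cover_ses B.
have [M [m [l [a [sm sl _]]]]] := ses_rotate si sj.
move=> K' R' i' p' pR' si'.
apply: (ext_indep_at Vm Vl si' sm pR' pR).
by apply: Vm sl _ eC; apply: eB sj.
Qed.

(** The two statements need a joint induction: the step for the middle term uses the left-hand
    statement one degree lower, and the step for the left term uses [ext_right_at], which rests on
    both. *)
Lemma ext_mid_left k Y : ext_mid_at k Y /\ ext_left_at k Y.
Proof.
elim: k => [|k [Vm Vl]]; split=> C B D i p si.
- move=> eC eD K E j q sj g.
  have [M [m [l [a [sm sl lE]]]]] := ses_rotate si sj.
  have [h hE] := eC _ _ _ _ sl g; have [f fE] := eD _ _ _ _ sm h.
  by exists f => x; rewrite -lE fE hE.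
- move=> eB eD.
  have [K [R [j [q [pR sj]]]]] := cover_ses B.
  have [M [m [l [a [sm sl lE]]]]] := ses_rotate si sj.
  apply: ext0_ext sl _ (eD _ _ _ _ pR sm) => // g.
  have [h hE] := eB _ _ _ _ sj g.
  by exists (h \o m) => x; rewrite /= lE hE.
- move=> eC eD K R j q pR sj.
  have [M [m [l [a [sm sl lE]]]]] := ses_rotate si sj.
  exact: Vl sl (eD _ _ _ _ pR sm) eC.
- move=> eB eD.
  have [K [R [j [q [pR sj]]]]] := cover_ses B.
  have [M [m [l [a [sm sl lE]]]]] := ses_rotate si sj.
  exact: ext_right_at Vm Vl _ _ _ _ _ sl (eB _ _ _ _ pR sj) (eD _ _ _ _ pR sm).
Qed.

Lemma ext_mid k Y C B D (i : {linear C -> B}) (p : {linear B -> D}) :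
  ses i p -> ext k C Y -> ext k D Y -> ext k B Y.
Proof. exact: (ext_mid_left k Y).1. Qed.

Lemma ext_left k Y C B D (i : {linear C -> B}) (p : {linear B -> D}) :
  ses i p -> ext k B Y -> ext k.+1 D Y -> ext k C Y.
Proof. exact: (ext_mid_left k Y).2. Qed.

Lemma ext_right k Y C B D (i : {linear C -> B}) (p : {linear B -> D}) :
  ses i p -> ext k C Y -> ext k.+1 B Y -> ext k.+1 D Y.
Proof. have [Vm Vl] := ext_mid_left k Y; exact: ext_right_at. Qed.

Lemma ext_shift k Y X K Q (i : {linear K -> Q}) (p : {linear Q -> X}) :
  ses i p -> projective Q -> ext k K Y <-> ext k.+1 X Y.
Proof.
by move=> si pQ; split=> [eK|eX]; [apply: ext_right si eK (ext_proj _ _ pQ) | apply: eX si].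
Qed.

Lemma ext0_cover X Y K Q (i : {linear K -> Q}) (p : {linear Q -> X}) :
  ses i p -> projective Q ->
  (forall g : {linear K -> Y}, exists h : {linear Q -> Y}, forall x, h (i x) = g x) ->
  ext0 X Y.
Proof. by move=> si pQ eY; exact: ext0_ext si eY (ext0_proj pQ). Qed.

Lemma ext_bij k X X' Y (f : {linear X -> X'}) : bijective f -> ext k X' Y -> ext k X Y.
Proof. by move/ses_zmodl => s; apply: ext_mid s (ext_proj _ _ (@projective_zmod A)). Qed.

Lemma ext_retract k X Y Y' (s : {linear Y -> Y'}) (r : {linear Y' -> Y}) :
  cancel s r -> ext k X Y' -> ext k X Y.
Proof.
move=> sK; elim: k X => [|k IH] X eX K B i p.
  move=> si g; have [h hE] := eX _ _ _ _ si (s \o g).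
  by exists (r \o h) => x; rewrite /= hE /= sK.
by move=> pB si; apply: IH; apply: eX si.
Qed.

Lemma ext_bij2 k X Y Y' (f : {linear Y -> Y'}) : bijective f -> ext k X Y' -> ext k X Y.
Proof. by move=> /bij_linv[g [fK gK]]; apply: ext_retract fK. Qed.

Lemma ext0_lift X C B D (i : {linear C -> B}) (p : {linear B -> D})
    (g : {linear X -> D}) : ses i p -> ext0 X C ->
  exists h : {linear X -> B}, forall x, p (h x) = g x.
Proof.
move=> si eX; have [j [sj jE]] := pb_ses_snd g si.
have [r rE] := eX _ _ _ _ sj idfun; have [ij jp sp] := sj.
have [|h hE] := @exact_cofactor A _ _ _ B j _ (pb_fst p g \- (i \o r)) jp sp.
  by move=> x; rewrite !linE rE jE subrr.
exists h => x; have [y <-] := sp x.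
by rewrite hE !linE linearB (ses_comp0 _ si) subr0 pb_comm.
Qed.

(** This is exactness of Hom(X, B) -> Hom(X, D) -> Ext^1(X, C) -> Ext^1(X, B). *)
Lemma ext0_ker2 X C B D (i : {linear C -> B}) (p : {linear B -> D}) :
  ses i p -> ext0 X B ->
  (forall g : {linear X -> D}, exists h : {linear X -> B}, forall x, p (h x) = g x) ->
  ext0 X C.
Proof.
move=> si eX lX; have [ii ip sp] := si.
have [K [Q [j [q [pQ sj]]]]] := cover_ses X; have [ij jq sq] := sj.
apply: (ext0_cover sj pQ) => g.
have [h hE] := eX _ _ _ _ sj (i \o g).
have [|u uE] := @exact_cofactor A _ _ _ D j q (p \o h) jq sq.
  by move=> x; rewrite /= hE (ses_comp0 _ si).
have [l lE] := lX u.
have [|v vE] := @exact_factor A _ _ _ _ i p (h \- (l \o q)) ii ip.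
  by move=> x; rewrite !linE linearB lE uE /= subrr.
exists v => x; apply: ii; rewrite vE !linE.
by rewrite hE (ses_comp0 _ sj) linear0 subr0.
Qed.

Lemma ext_right2 k X C B D (i : {linear C -> B}) (p : {linear B -> D}) :
  ses i p -> ext k X B -> ext k.+1 X C -> ext k X D.
Proof.
move=> si; elim: k X => [|k IH] X eB eC.
  have [K [Q [j [q [pQ sj]]]]] := cover_ses X.
  apply: (ext0_cover sj pQ) => g.
  have [l lE] := ext0_lift g si (eC _ _ _ _ pQ sj).
  have [h hE] := eB _ _ _ _ sj l.
  by exists (p \o h) => x; rewrite /= hE lE.
move=> K Q j q pQ sj; apply: IH; [exact: eB sj | exact: eC sj].
Qed.

Lemma ext_left2 k X C B D (i : {linear C -> B}) (p : {linear B -> D}) :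
  ses i p -> ext k X D -> ext k.+1 X B -> ext k.+1 X C.
Proof.
move=> si; elim: k X => [|k IH] X eD eB K Q j q pQ sj.
  apply: (ext0_ker2 si (eB _ _ _ _ pQ sj)) => g.
  have [h hE] := eD _ _ _ _ sj g; have [ii ip sp] := si.
  by have [l lE] := pQ _ _ p h sp; exists (l \o j) => x; rewrite /= lE hE.
by apply: IH; [apply: eD sj | apply: eB sj].
Qed.

Lemma ext_row k X m : ext k X (A^o : lmodType A) -> ext k X 'rV[A]_m.
Proof.
elim: k X => [|k IH] X eX K B i p.
  move=> si g.
  have gl (j : 'I_m) : linear (fun x => g x 0 j : A^o).
    by move=> a x y; rewrite linearP !mxE.
  have /fin_all_exists[h hE] j := eX _ _ _ _ si (mklin (gl j)).
  have hl : linear (fun x => \row_j (h j x : A)).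
    by move=> a x y; apply/rowP => j; rewrite !mxE linearP.
  by exists (mklin hl) => x; apply/rowP => j; rewrite !mxE hE.
by move=> pB si; apply: IH; apply: eX si.
Qed.

Lemma ext_fgproj k X Q : fin_gen Q -> projective Q ->
  ext k X (A^o : lmodType A) -> ext k X Q.
Proof.
move=> /fin_genP[m [p sp]] pQ /(ext_row m); have [s sE] := pQ _ _ p idfun sp.
exact: ext_retract sE.
Qed.

Section Syzygy.
Variables (X : lmodType A) (P : proj_resolution X).

Definition aug_ker : lmodType A := kermod (res_aug P).

Lemma res_aug_d x : res_aug P (res_d P 0 x) = 0.
Proof. by apply/(@res_exact0 _ _ P); exists x. Qed.

Definition aug_cov : {linear P 1 -> aug_ker} := ker_corestr res_aug_d.

Lemma aug_covE x : ker_incl (aug_cov x) = res_d P 0 x. Proof. by []. Qed.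

Lemma aug_cov_surj : surjective aug_cov.
Proof.
move=> y; have /(@res_exact0 _ _ P)[x xE] := ker_incl0 y.
by exists x; apply: ker_incl_inj.
Qed.

Lemma aug_cov_exact : exact_at (res_d P 1) aug_cov.
Proof.
move=> y; rewrite -(@res_exact _ _ P 0 _); split=> [|e].
  by move/(congr1 (@ker_incl A _ _ _)).
by apply: ker_incl_inj; rewrite aug_covE e.
Qed.

Definition shift_res : proj_resolution aug_ker :=
  ProjResolution (fun k => @res_proj _ _ P k.+1) aug_cov_surj aug_cov_exact
    (fun k => @res_exact _ _ P k.+1).

End Syzygy.

(** Dimension shifting: [shift_res] resolves the kernel of the augmentation, and in degree one a
    cocycle is the same as a map out of that kernel. *)
Lemma hom_acyclic_ext k X (P : proj_resolution X) Y :
  hom_acyclic_at P Y k.+1 <-> ext k X Y.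
Proof.
elim: k X P => [|k IH] X P; have sk := ses_ker (@res_aug_surj _ _ P).
  have sc := @aug_cov_surj _ P.
  split=> [aP|eX g gd].
    apply: (ext0_cover sk (@res_proj _ _ P 0)) => g.
    have [x|h hE] := aP (g \o aug_cov P).
      by rewrite /= (proj2 (aug_cov_exact _)) ?linear0 //; exists x.
    by exists h => y; have [x <-] := sc y; exact: esym (hE x).
  have [u uE] := exact_cofactor (@aug_cov_exact _ P) sc gd.
  have [h hE] := eX _ _ _ _ sk u.
  by exists h => x; rewrite -uE -hE.
apply: iff_trans (ext_shift _ _ sk (@res_proj _ _ P 0)).
exact: (IH _ (shift_res P)).
Qed.

Section FreeResolution.
Variable X : lmodType A.

Definition free_map (M : lmodType A) : {linear {freeg M / A} -> M} := free_lin id.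

Lemma free_map_surj M : surjective (free_map M).
Proof. by move=> x; exists << x >>; rewrite /= liftU scale1r. Qed.

Fixpoint free_syz (k : nat) : lmodType A :=
  if k is l.+1 then kermod (free_map (free_syz l)) else X.

Definition free_ob k : lmodType A := {freeg (free_syz k) / A}.

Definition free_d k : {linear free_ob k.+1 -> free_ob k} :=
  @ker_incl A _ _ (free_map (free_syz k)) \o free_map (free_syz k.+1).

Lemma free_exact k (Y : lmodType A) (i : {linear free_syz k -> Y}) : injective i ->
  exact_at (free_d k) (i \o free_map (free_syz k)).
Proof.
move=> ii y; have -> : (i \o free_map (free_syz k)) y = 0 <-> free_map (free_syz k) y = 0.
  split=> [|e]; last by rewrite lin_compE e linear0.
  by rewrite lin_compE -[RHS](linear0 i); apply: ii.
rewrite ker_incl_exact; split=> [[x <-]|[x <-]]; last by exists (free_map (free_syz k.+1) x).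
by have [z <-] := @free_map_surj (free_syz k.+1) x; exists z.
Qed.

Definition free_res : proj_resolution X :=
  @ProjResolution A X free_ob free_d (free_map X)
    (fun k => @projective_freeg A (free_syz k)) (@free_map_surj X)
    (@free_exact 0 X idfun (@inj_id X))
    (fun k => @free_exact k.+1 _ _ (@ker_incl_inj _ _ _ (free_map (free_syz k)))).

End FreeResolution.

(** Since [Ext_vanish] quantifies over all resolutions, the forward direction depends on the
    existence of one, namely [free_res]. *)
Lemma Ext_vanishE k X Y : Ext_vanish k.+1 X Y <-> ext k X Y.
Proof.
split=> [eX|eX P]; last exact/hom_acyclic_ext.
exact/(hom_acyclic_ext k (free_res X))/eX.
Qed.

End Ext.


(** * Commutative artinian rings are noetherian *)

Section Span.
Variables (R : pzRingType) (M : lmodType R).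
Implicit Types (s t : seq M) (x y : M) (N : M -> Prop).

Fixpoint span s x : Prop :=
  if s is e :: s' then exists (a : R) (y : M), span s' y /\ x = a *: e + y
  else x = 0.

Definition submod N : Prop :=
  [/\ N 0, forall x y, N x -> N y -> N (x + y) & forall a x, N x -> N (a *: x)].

Definition fgsub N : Prop :=
  exists s, (forall x, x \in s -> N x) /\ forall x, N x -> span s x.

Lemma span_submod s : submod (span s).
Proof.
elim: s => [|e s [s0 sD sZ]]; split=> //=.
- by move=> x y -> ->; rewrite addr0.
- by move=> a x ->; rewrite scaler0.
- by exists 0, 0; rewrite scale0r addr0.
- move=> x y [a [x' [sx ->]]] [b [y' [sy ->]]]; exists (a + b), (x' + y').
  by split; [apply: sD | rewrite scalerDl addrACA].
- move=> a x [b [y [sy ->]]]; exists (a * b), (a *: y).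
  by split; [apply: sZ | rewrite scalerDr scalerA].
Qed.

Lemma span_mem s x : x \in s -> span s x.
Proof.
elim: s => [//|e s IH]; rewrite inE => /orP[/eqP->|/IH sx].
  exists 1, 0; rewrite scale1r addr0; split=> //.
  by have [] := span_submod s.
by exists 0, x; rewrite scale0r add0r.
Qed.

Lemma span_sub N s x : submod N -> (forall e, e \in s -> N e) -> span s x -> N x.
Proof.
move=> [N0 ND NZ]; elim: s x => [|e s IH] x sN /=; first by move->.
move=> [a [y [sy ->]]]; apply: ND; first exact/NZ/sN/mem_head.
by apply: IH => // z zs; apply: sN; rewrite inE zs orbT.
Qed.

Lemma span_subset s t x : {subset s <= t} -> span s x -> span t x.
Proof. by move=> st; apply: span_sub (span_submod t) _ => e /st/span_mem. Qed.

Lemma span_cat s t x y : span s x -> span t y -> span (s ++ t) (x + y).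
Proof.
move=> sx ty; have [_ sD _] := span_submod (s ++ t).
by apply: sD; [move: sx | move: ty]; apply: span_subset => e es;
  rewrite mem_cat es ?orbT.
Qed.

Lemma submodN N x : submod N -> N x -> N (- x).
Proof. by case=> _ _ NZ Nx; rewrite -scaleN1r; apply: NZ. Qed.

Lemma submodB N x y : submod N -> N x -> N y -> N (x - y).
Proof.
move=> sN Nx Ny; have [_ ND _] := sN.
by apply: ND => //; apply: submodN.
Qed.

Lemma spanP s x : span s x <->
  exists c : 'I_(size s) -> R, x = \sum_(i < size s) c i *: s`_i.
Proof.
elim: s x => [|e s IH] x /=.
  split=> [->|[c ->]]; last by rewrite big_ord0.
  by exists (fun=> 0); rewrite big_ord0.
split=> [[a [y [/IH[c ->] ->]]]|[c ->]].
  exists (fun i => if unlift ord0 i is Some j then c j else a).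
  rewrite big_ord_recl unlift_none; congr (_ + _).
  by apply: eq_bigr => i _; rewrite liftK.
exists (c ord0), (\sum_(i < size s) c (fintype.lift ord0 i) *: s`_i).
by split; [apply/IH; exists (fun i => c (fintype.lift ord0 i)) | rewrite big_ord_recl].
Qed.

Lemma fin_gen_span : fin_gen M <-> exists s, forall x, span s x.
Proof.
split=> [[k [e eP]]|[s sP]].
  exists (codom e) => x; have [c ->] := eP x.
  have [s0 sD sZ] := span_submod (codom e).
  apply: (big_ind (span (codom e))) => // i _.
  by apply/sZ/span_mem/codom_f.
exists (size s), (fun i => s`_i) => x; exact/spanP/sP.
Qed.

End Span.

Section Artinian.
Variable R : comPzRingType.
Hypothesis artR : artinian R.
Implicit Types I J : R -> Prop.

Let fgideal I := @fgsub R R^o I.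

(** Otherwise dependent choice produces a strictly decreasing sequence of ideals. *)
Lemma minimal_nonfg I : is_ideal I -> ~ fgideal I ->
  exists J, [/\ is_ideal J, ~ fgideal J &
    forall K, is_ideal K -> (forall x, K x -> J x) ->
      fgideal K \/ forall x, J x -> K x].
Proof.
move=> iI nI; apply: NNPP => noJ.
pose T := {J : R -> Prop | is_ideal J /\ ~ fgideal J}.
have step (J : T) : exists K : T, (forall x, sval K x -> sval J x) /\
    ~ forall x, sval J x -> sval K x.
  case: J => J [iJ nJ] /=; apply: NNPP => noK; apply: noJ; exists J; split=> //.
  move=> K iK KJ; apply: NNPP => /not_or_and[nK nJK]; apply: noK.
  by exists (exist _ K (conj iK nK)).
pose next (J : T) : T := proj1_sig (constructive_indefinite_description _ (step J)).
have nextP (J : T) := proj2_sig (constructive_indefinite_description _ (step J)).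
pose Is k : T := iter k next (exist _ I (conj iI nI)).
have [||m mP] := artR (I := fun k => sval (Is k)).
- by move=> k; case: (Is k) => K [].
- by move=> k; apply: (nextP (Is k)).1.
by apply: (nextP (Is m)).2; apply: mP m.+1 _.
Qed.

(* An ideal I minimal among those that are not finitely generated is a vector
   space over the field R / ann I, as every a in R acts on I by 0 or invertibly;
   the spans of the tails of an infinite independent sequence would then be a
   strictly decreasing chain of ideals. *)
Section Minimal.
Variable I : R -> Prop.
Hypotheses (iI : is_ideal I) (nI : ~ fgideal I).
Hypothesis minI : forall K, is_ideal K -> (forall x, K x -> I x) ->
  fgideal K \/ forall x, I x -> K x.

Let ann a := forall x, I x -> a * x = 0.

(** The ideal a I and the elements of I killed by a are both contained in I. If both were proper,
    both would be finitely generated by minimality, and so would I, which is an extension of the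
    first by the second. *)
Lemma minimal_mul a : ann a \/ forall x, I x -> exists2 y, I y & x = a * y.
Proof.
have [I0 ID IM] := iI.
have [||[s [sI sP]]|H] := @minI (fun x => exists2 y, I y & x = a * y); last by right.
- split=> [|x y [x' Ix ->] [y' Iy ->]|b x [x' Ix ->]].
  + by exists 0; rewrite ?mulr0.
  + by exists (x' + y'); rewrite ?mulrDr //; apply: ID.
  + by exists (b * x'); [apply: IM | rewrite mulrCA].
- by move=> x [y Iy ->]; apply: IM.
have [||[t [tI tP]]|H] := @minI (fun x => I x /\ a * x = 0); last by left=> x /H[].
- split=> [|x y [Ix ax] [Iy ay]|b x [Ix ax]].
  + by rewrite mulr0.
  + by rewrite mulrDr ax ay addr0; split=> //; apply: ID.
  + by rewrite mulrCA ax mulr0; split=> //; apply: IM.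
- by move=> x [].
case: nI.
have [u [uI uP]] : exists u : seq R^o, (forall x, x \in u -> I x) /\
    forall z, span s z -> exists2 y : R^o, span u y & z = a * y.
  elim: {sP} s sI => [|e s IH] sI.
    by exists [::]; split=> // z ->; exists 0; rewrite ?mulr0.
  have [|u [uI uP]] := IH; first by move=> x xs; apply: sI; rewrite inE xs orbT.
  have [y Iy ey] := sI e (mem_head _ _); exists (y :: u); split.
    by move=> x; rewrite inE => /orP[/eqP->|/uI].
  move=> z [b [w [/uP[v uv ->] ->]]]; exists (b *: (y : R^o) + v).
    by exists b, v.
  by rewrite ey mulrDr; congr (_ + _); rewrite /GRing.scale /= mulrCA.
exists (u ++ t); split.
  by move=> x; rewrite mem_cat => /orP[/uI|/tI[]].
move=> x Ix; have [|y uy axy] := uP (a * x); first by apply: sP; exists x.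
rewrite -[x](subrK y) addrC; apply: span_cat => //; apply: tP; split; last first.
  by rewrite mulrBr axy subrr.
exact: (@submodB R R^o I) iI Ix (@span_sub R R^o I u y iI uI uy).
Qed.

(** The ideals [V k] of those r that act on I like some multiple of a^k become stationary, so a^m =
    a^(m+1) b on I for some b. As I = a^m I, this b inverts a on I. *)
Lemma minimal_inv a : ann a \/ exists b, forall x, I x -> b * (a * x) = x.
Proof.
have [I0 ID IM] := iI.
have [|aI] := minimal_mul a; first by left.
right; pose V k r := exists b, ann (r - a ^+ k * b).
have [||m mP] := artR (I := V).
- move=> k; split.
  + by exists 0 => x _; rewrite mulr0 subr0 mul0r.
  + move=> r s [b bP] [c cP]; exists (b + c) => x Ix.
    by rewrite mulrDr opprD addrACA mulrDl bP ?cP ?addr0.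
  + move=> r s [b bP]; exists (r * b) => x Ix.
    by rewrite mulrCA -mulrBr -mulrA bP // mulr0.
- by move=> k r [b bP]; exists (a * b); rewrite mulrA -exprSr.
have [|b bP] := mP m.+1 (leqnSn m) (a ^+ m).
  by exists 1 => x _; rewrite mulr1 subrr mul0r.
exists b => x Ix.
have [y Iy ->] : exists2 y, I y & x = a ^+ m * y.
  elim: m {mP bP} x Ix => [|m IH] x Ix; first by exists x; rewrite ?mul1r.
  have [y Iy ->] := aI x Ix; have [z Iz ->] := IH y Iy.
  by exists z; rewrite // mulrA -exprS.
have := bP y Iy; rewrite mulrBl => /subr0_eq e.
by rewrite [RHS]e exprS -!mulrA mulrCA; congr (a * _); rewrite mulrCA.
Qed.

Lemma minimal_absurd : False.
Proof.
have [I0 ID IM] := iI.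
(* The condition that s lies in I is placed under the existential, so that choice gives a function
   [nx] on all sequences. For s not in I any witness will do, and 0 is used. *)
have ex (s : seq R^o) : exists x : R^o, (forall y, y \in s -> I y) -> I x /\ ~ @span R R^o s x.
  apply: NNPP => no; apply: nI; exists s; split=> x => [xs|Ix].
    by apply: NNPP => nIx; apply: no; exists 0 => /(_ x xs).
  by apply: NNPP => nsx; apply: no; exists x.
pose nx (s : seq R^o) : R^o := proj1_sig (constructive_indefinite_description _ (ex s)).
have nxP s := proj2_sig (constructive_indefinite_description _ (ex s)).
pose pre := fix pre k : seq R^o := if k is l.+1 then nx (pre l) :: pre l else [::].
pose xs k : R^o := nx (pre k).
have preI k : forall y, y \in pre k -> I y.
  elim: k => [//|k IH] y /=; rewrite inE => /orP[/eqP->|/IH//].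
  by have [] := nxP (pre k) IH.
have xsI k : I (xs k) by have [] := nxP (pre k) (preI k).
have xsN k : ~ @span R R^o (pre k) (xs k) by have [] := nxP (pre k) (preI k).
have mem_pre j k : (j < k)%N -> xs j \in pre k.
  elim: k => [//|k IH]; rewrite ltnS leq_eqVlt /= inE => /orP[/eqP->|/IH->].
    by rewrite eqxx.
  by rewrite orbT.
(* [pre k] lists x_0, ..., x_(k-1), and [tl k m] lists x_k, ..., x_(k+m-1), in both cases with the
   last one in front. *)
pose tl := fix tl k m : seq R^o := if m is l.+1 then xs (k + l)%N :: tl k l else [::].
have tl_mem k m j : (j < m)%N -> xs (k + j)%N \in tl k m.
  elim: m => [//|m IH]; rewrite ltnS leq_eqVlt /= inE => /orP[/eqP->|/IH->].
    by rewrite eqxx.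
  by rewrite orbT.
have tlP k m x : x \in tl k m -> exists2 j, (j < m)%N & x = xs (k + j)%N.
  elim: m => [//|m IH] /=; rewrite inE => /orP[/eqP->|/IH[j jm ->]].
    by exists m.
  by exists j => //; apply: leqW.
pose V k (x : R^o) := exists m, span (tl k m) x.
have tl_mono k m m' (x : R^o) : (m <= m')%N -> span (tl k m) x -> span (tl k m') x.
  move=> mm; apply: span_subset => y /tlP[j jm ->].
  exact: tl_mem (leq_trans jm mm).
have [||m mP] := artR (I := V).
- move=> k; split; first by exists 0%N.
  + move=> x y [m mx] [m' my]; exists (maxn m m').
    have [_ sD _] := span_submod (tl k (maxn m m')).
    by apply: sD; [move: mx | move: my]; apply: tl_mono; rewrite ?leq_maxl ?leq_maxr.
  + by move=> a x [m mx]; exists m; have [_ _ sZ] := span_submod (tl k m); apply: sZ.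
- move=> k x [m mx]; exists m.+1; move: mx; apply: span_subset => y /tlP[j jm ->].
  by rewrite addSnnS; apply: tl_mem.
have [|l] := mP m.+1 (leqnSn m) (xs m).
  by exists 1%N; apply: (@span_mem R R^o); rewrite -[X in xs X]addn0; apply: tl_mem.
(* Now x_m is a combination of later terms. If the coefficient of the last one kills I, that term
   drops out; otherwise it is invertible on I and the last term lies in the span of its
   predecessors. *)
elim: l => [|l IH] /=.
  move=> e; apply: (xsN m); rewrite [xs m]e.
  by have [] := span_submod (pre m).
move=> [c [y [sy e]]].
have [/(_ _ (xsI _)) c0|[b bP]] := minimal_inv c.
  by apply: IH; rewrite e; move: c0; rewrite /GRing.scale /= => ->; rewrite add0r.
apply: (xsN (m.+1 + l)%N); rewrite -[xs _](bP _ (xsI _)).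
have -> : c * xs (m.+1 + l)%N = xs m - y by rewrite e addrK.
have sP := span_submod (pre (m.+1 + l)%N); have [_ _ sZ] := sP.
apply: (sZ b (xs m - y)); apply: submodB => //.
  by apply: span_mem; apply: mem_pre; rewrite addSn ltnS leq_addr.
apply: span_subset sy => z /tlP[j jl ->]; apply: mem_pre.
by rewrite ltn_add2l.
Qed.

End Minimal.

Lemma artinian_fgideal I : is_ideal I -> fgideal I.
Proof.
move=> iI; apply: NNPP => nI; have [J [iJ nJ mJ]] := minimal_nonfg iI nI.
exact: minimal_absurd iJ nJ mJ.
Qed.

Section FgModules.
Variable M : lmodType R.

(** The coefficients of [e] in the elements of N form an ideal, which is finitely generated. Lifts
    of its generators to N, together with generators of the intersection of N with the span of [s],
    generate N. *)
Lemma artinian_fgsub (N : M -> Prop) s :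
  submod N -> (forall x, N x -> span s x) -> fgsub N.
Proof.
elim: s N => [|e s IH] N sN Ns.
  by exists [::]; split=> // x /Ns.
have [N0 ND NZ] := sN; have [s0 sD sZ] := span_submod s.
pose I a := exists2 y, span s y & N (a *: e + y).
have iI : is_ideal I.
  split=> [|a b [y sy Ny] [z sz Nz]|a b [y sy Ny]].
  - by exists 0; rewrite ?scale0r ?addr0.
  - exists (y + z); first exact: sD.
    by rewrite scalerDl addrACA; apply: ND.
  - exists (a *: y); first exact: sZ.
    by rewrite -scalerA -scalerDr; apply: NZ.
have [as_ [asI asP]] := artinian_fgideal iI.
have [ns [nsN nsP]] : exists ns, (forall x, x \in ns -> N x) /\
    forall a : R^o, span as_ a -> exists2 y, span s y & span ns (a *: e + y).
  elim: {asP} as_ asI => [|a0 as_ IHa] asI.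
    by exists [::]; split=> // a ->; exists 0; rewrite //= scale0r addr0.
  have [|ns [nsN nsP]] := IHa; first by move=> x xs; apply: asI; rewrite inE xs orbT.
  have [y sy Ny] := asI a0 (mem_head _ _); exists (a0 *: e + y :: ns); split.
    by move=> x; rewrite inE => /orP[/eqP->|/nsN].
  move=> a [b [a' [/nsP[z sz nz] ->]]]; exists (b *: y + z).
    by apply: sD => //; apply: sZ.
  exists b, (a' *: e + z); split=> //.
  by rewrite scalerDl addrACA scalerDr scalerA.
have [||t [tN tP]] := IH (fun x => N x /\ span s x); last 1 first.
- exists (ns ++ t); split.
    by move=> x; rewrite mem_cat => /orP[/nsN|/tN[]].
  move=> x Nx; have [a [y [sy ex]]] := Ns x Nx.
  have [|z sz nz] := nsP a; first by apply: asP; exists y; rewrite -?ex.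
  have Nz := span_sub sN nsN nz.
  rewrite -[x](subrK (a *: e + z)) addrC; apply: span_cat => //; apply: tP.
  split; first exact: submodB.
  rewrite ex opprD addrACA subrr add0r.
  exact: submodB (span_submod s) sy sz.
- split=> [//|x y [Nx sx] [Ny sy]|a x [Nx sx]]; split; do ?[exact: ND|exact: NZ|exact: sD|exact: sZ].
- by move=> x [].
Qed.

End FgModules.
End Artinian.

(** * Restriction of scalars and finite generation of kernels *)

Definition restrict (R : comPzRingType) (A : pzRingType)
  (phi : {rmorphism R -> A}) (M : lmodType A) : Type := M.

Section Restriction.
Variables (R : comPzRingType) (A : pzRingType) (phi : {rmorphism R -> A}).
Local Notation restrict := (@restrict R A phi).

Section Instance.
Variable M : lmodType A.

HB.instance Definition _ := GRing.Zmodule.on (restrict M).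

Definition restrict_scale (a : R) (x : restrict M) : restrict M := phi a *: (x : M).

Lemma restrict_scaleA a b x :
  restrict_scale a (restrict_scale b x) = restrict_scale (a * b) x.
Proof. by rewrite /restrict_scale scalerA rmorphM. Qed.
Lemma restrict_scale1 : left_id 1 restrict_scale.
Proof. by move=> x; rewrite /restrict_scale rmorph1 scale1r. Qed.
Lemma restrict_scaleDr : right_distributive restrict_scale +%R.
Proof. by move=> a x y; rewrite /restrict_scale -scalerDr. Qed.
Lemma restrict_scaleDl x : {morph restrict_scale^~ x : a b / a + b}.
Proof. by move=> a b; rewrite /restrict_scale rmorphD scalerDl. Qed.

HB.instance Definition _ := GRing.Zmodule_isLmodule.Build R (restrict M)
  restrict_scaleA restrict_scale1 restrict_scaleDr restrict_scaleDl.

Lemma restrictE (a : R) (x : restrict M) : a *: x = phi a *: (x : M).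
Proof. by []. Qed.

End Instance.

Hypothesis artR : artinian R.
Hypothesis fgA : fin_gen (restrict (A^o : lmodType A)).

Let prods (M : lmodType A) (t : seq A) (s : seq M) : seq (restrict M) :=
  allpairs (fun a x => a *: x) t s.

Lemma restrict_fin_gen (M : lmodType A) : fin_gen M -> fin_gen (restrict M).
Proof.
move=> /fin_gen_span[s sP]; have /fin_gen_span[t tP] := fgA.
apply/fin_gen_span; exists (prods t s) => x.
have := sP x; elim: {sP} s x => [|e s IH] x /=.
  by move=> ->; have [] := @span_submod R (restrict M) (prods t [::]).
move=> [a [y [/IH sy ->]]].
have sub (s' : seq M) : {subset s' <= e :: s} ->
    {subset (prods t s') <= (prods t (e :: s))}.
  by move=> ss z0 /allpairsP[[b z] [/= bt zs ->]]; apply: allpairs_f => //; apply: ss.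
have [_ sD _] := @span_submod R (restrict M) (prods t (e :: s)).
apply: sD; last first.
  by apply: (span_subset _ sy); apply: sub => z zs; rewrite inE zs orbT.
apply: (@span_subset _ (restrict M) [seq (b : A) *: (e : M) | b <- t]).
  move=> _ /mapP[b bt ->]; apply: allpairs_f => //; exact: mem_head.
have := tP a; elim: (t) a => [|b t' IHt] a /=.
  by move=> ->; rewrite scale0r.
move=> [r [c [/IHt sc ->]]]; exists r, ((c : A) *: e : restrict M); split=> //.
by rewrite scalerDl; congr (_ + _); rewrite !restrictE scalerA.
Qed.

Lemma restrict_fgsub (M : lmodType A) (N : restrict M -> Prop) :
  fin_gen M -> submod N -> fgsub N.
Proof.
move=> /restrict_fin_gen/fin_gen_span[s sP] sN.
exact: (@artinian_fgsub R artR _ N s).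
Qed.

(** The kernel is already finitely generated over R, and generators over R also generate over A. *)
Lemma fin_gen_ker (U V : lmodType A) (f : {linear U -> V}) :
  fin_gen U -> fin_gen (kermod f).
Proof.
move=> fU; have [|s [sN sP]] := @restrict_fgsub U (fun x => f x = 0) fU.
  split=> [|x y fx fy|a x fx]; first by rewrite linear0.
    by rewrite [f _](linearD f) fx fy addr0.
  by rewrite [f _](linearZ_LR f) fx scaler0.
have [t tE] : exists t : seq (kermod f), map (@ker_incl A _ _ f) t = s.
  elim: {sP} s sN => [|e s IH] sN; first by exists [::].
  have [|t tE] := IH; first by move=> x xs; apply: sN; rewrite inE xs orbT.
  have /(ker_incl_exact f)[y yE] := sN e (mem_head _ _).
  by exists (y :: t); rewrite /= tE -yE.
apply/fin_gen_span; exists t => x.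
have := sP (ker_incl x) (ker_incl0 x); rewrite -tE.
elim: (t) x => [|e t' IH] x /=.
  by move=> e; apply: ker_incl_inj; rewrite e.
move=> [r [y [sy ex]]].
have yE : ker_incl (x - phi r *: e) = y.
  rewrite [LHS](linearB (@ker_incl A _ _ f)) [X in _ - X](linearZ_LR (@ker_incl A _ _ f)).
  by rewrite /= ex addrC; apply: addKr.
exists (phi r), (x - phi r *: e); split; last by rewrite addrC subrK.
by apply: IH; rewrite yE.
Qed.

End Restriction.


(** * Cokernels, injective dimension, approximations *)

Section Cokernel.
Variables (A : pzRingType) (U V : lmodType A) (j : {linear U -> V}).

(** The quotient construction asks for a boolean predicate, while membership in an image is a mere
    proposition; hence the appeal to excluded middle. *)
Definition im_pred : {pred V} := fun y =>
  if excluded_middle_informative (exists x, j x = y) then true else false.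

Lemma im_predP y : reflect (exists x, j x = y) (y \in im_pred).
Proof. by rewrite unfold_in; case: excluded_middle_informative; constructor. Qed.

Lemma im_pred_zmod_closed : zmod_closed im_pred.
Proof.
split=> [|_ _ /im_predP[x <-] /im_predP[y <-]]; apply/im_predP.
  by exists 0; rewrite linear0.
by exists (x - y); rewrite linearB.
Qed.

HB.instance Definition _ := GRing.isZmodClosed.Build V im_pred im_pred_zmod_closed.

Definition coker : Type := Quotient.quot im_pred.

HB.instance Definition _ := GRing.Zmodule.on coker.

Definition coker_proj (x : V) : coker := (\pi_(Quotient.quot im_pred) x)%qT.

Lemma coker_projD : {morph coker_proj : x y / x + y}.
Proof. exact: raddfD. Qed.

Lemma coker_proj_surj (y : coker) : exists x, coker_proj x = y.
Proof. by exists (repr (y : Quotient.quot im_pred)); apply: reprK. Qed.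

Lemma coker_projP x y : coker_proj x = coker_proj y <-> exists u, j u = x - y.
Proof.
have H := Quotient.idealrBE im_pred x y.
by split=> [e|/im_predP]; [apply/im_predP; rewrite H | rewrite H => /eqP]; rewrite ?e //; apply/eqP.
Qed.

Definition coker_scale (a : A) (y : coker) : coker :=
  coker_proj (a *: repr (y : Quotient.quot im_pred)).

Lemma coker_projZ a x : coker_proj (a *: x) = coker_scale a (coker_proj x).
Proof.
apply/coker_projP; rewrite -scalerBr.
have /coker_projP[u uE] : coker_proj x =
    coker_proj (repr (coker_proj x : Quotient.quot im_pred)).
  by symmetry; apply: reprK.
by exists (a *: u); rewrite linearZ_LR uE.
Qed.

Lemma coker_scaleA a b y : coker_scale a (coker_scale b y) = coker_scale (a * b) y.
Proof.
by have [x <-] := coker_proj_surj y; rewrite -!coker_projZ scalerA.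
Qed.
Lemma coker_scale1 : left_id 1 coker_scale.
Proof.
by move=> y; have [x <-] := coker_proj_surj y; rewrite -!coker_projZ scale1r.
Qed.
Lemma coker_scaleDr : right_distributive coker_scale +%R.
Proof.
move=> a y z; have [x <-] := coker_proj_surj y; have [t <-] := coker_proj_surj z.
by rewrite -!(coker_projZ, coker_projD) scalerDr.
Qed.
Lemma coker_scaleDl y : {morph coker_scale^~ y : a b / a + b}.
Proof.
move=> a b; have [x <-] := coker_proj_surj y.
by rewrite -!(coker_projZ, coker_projD) scalerDl.
Qed.

HB.instance Definition _ := GRing.Zmodule_isLmodule.Build A coker
  coker_scaleA coker_scale1 coker_scaleDr coker_scaleDl.

Lemma coker_proj_linear : linear coker_proj.
Proof. by move=> a x y; rewrite coker_projD coker_projZ. Qed.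

Lemma cokernel_exists : exists (W : lmodType A) (p : {linear V -> W}),
  exact_at j p /\ surjective p.
Proof.
exists (coker : lmodType A), (mklin coker_proj_linear); split; last exact: coker_proj_surj.
move=> y /=; have -> : (0 : coker) = coker_proj 0.
  by symmetry; apply: raddf0.
by rewrite coker_projP subr0.
Qed.

End Cokernel.

Section InjDim.
Variable A : nzRingType.
Implicit Types X Y Q K : lmodType A.

Lemma ext_injective k X Q : injective_module Q -> ext k X Q.
Proof.
move=> iQ; elim: k X => [|k IH] X K B i p; last by move=> _ _; apply: IH.
by move=> [ii _ _] g; apply: iQ.
Qed.

Lemma ext_zero2 k X Y : (forall y : Y, y = 0) -> ext k X Y.
Proof.
move=> Y0; elim: k X => [|k IH] X K B i p; last by move=> _ _; apply: IH.
by move=> _ g; exists \0 => x; rewrite [RHS]Y0.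
Qed.

(** Dimension shifting along the cosyzygies [V j] of the injective resolution, from [V m.+1], which
    is zero, back to [V 0], which is isomorphic to M. *)
Lemma finite_injdim_ext (M : lmodType A) : finite_injdim M ->
  exists d, forall k X, (d <= k)%N -> ext k X M.
Proof.
move=> [m [I mI]]; exists m.+1 => k X mk.
pose V j : lmodType A := kermod (cores_d I j).
have dd0 j x : cores_d I j.+1 (cores_d I j x) = 0.
  by apply/(@cores_exact _ _ I j); exists x.
have exV j : ses (@ker_incl _ _ _ (cores_d I j)) (ker_corestr (dd0 j)).
  split; [exact: ker_incl_inj | | ].
    move=> y; rewrite -ker_incl_exact; split=> [|e]; first by move/(congr1 (@ker_incl _ _ _ _)).
    exact: ker_incl_inj.
  move=> y; have /(@cores_exact _ _ I j)[x xE] := ker_incl0 y.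
  by exists x; apply: ker_incl_inj.
suff eV i j l : (i + j = m.+1)%N -> ext (i + l) X (V j).
  have := eV m.+1 0%N (k - m.+1)%N (addn0 _); rewrite subnKC // => eV0.
  have a0 x : cores_d I 0 (cores_aug I x) = 0.
    by apply/(@cores_exact0 _ _ I); exists x.
  apply: (@ext_bij2 _ _ _ _ _ (ker_corestr a0)) eV0.
  apply: inj_surj_bij => [x y /(congr1 (@ker_incl _ _ _ _))|y].
    exact: cores_aug_inj.
  have /(@cores_exact0 _ _ I)[x xE] := ker_incl0 y.
  by exists x; apply: ker_incl_inj.
elim: i j => [|i IH] j ij.
  apply: ext_zero2 => y; apply: ker_incl_inj; apply: mI.
  by rewrite -ij.
apply: ext_left2 (exV j) _ (ext_injective _ _ (@cores_inj _ _ I j)).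
by apply: IH; rewrite addnS.
Qed.

(* A projective [Q] may fail to be finitely generated, but a map from a finitely
   generated module into it only involves finitely many elements of the basis
   of a free module having [Q] as a direct summand. *)
Lemma ext0_projective X Q :
  (forall (U V : lmodType A) (f : {linear U -> V}), fin_gen U -> fin_gen (kermod f)) ->
  fin_gen X -> projective Q -> ext0 X (A^o : lmodType A) -> ext0 X Q.
Proof.
move=> fgk /fin_genP[m [p sp]] pQ eX.
have sk := ses_ker sp; apply: (ext0_cover sk (projective_row (k := m))) => g.
have [s sE] := pQ _ _ (free_map Q) idfun (@free_map_surj _ Q).
have [t [e eP]] := fgk _ _ p (fin_gen_row A m).
pose D := undup (flatten [seq dom (s (g (e i))) | i <- enum 'I_t]).
have [h hE] : exists h : {linear 'rV[A]_m -> Q}, forall x,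
    h (ker_incl x) = \sum_(z <- D) coeff z (s (g x)) *: z.
  elim: (D) => [|z D' [h hE]].
    by exists \0 => x; rewrite big_nil.
  have lc : linear (fun x => coeff z (s (g x)) : A^o).
    by move=> a x y; rewrite !linearP coeffD coeffZ.
  have [c cE] := eX _ _ _ _ sk (mklin lc).
  have lcz : linear (fun x => (c x : A) *: z).
    by move=> a x y; rewrite linearP scalerDl -scalerA.
  exists (mklin lcz \+ h) => x; rewrite big_cons lin_addE hE; congr (_ + _).
  by rewrite /= [c _]cE.
exists h => x; rewrite [LHS]hE.
have lH : linear (fun x => \sum_(z <- D) coeff z (s (g x)) *: z).
  move=> a u v; rewrite scaler_sumr -big_split; apply: eq_bigr => z _ /=.
  by rewrite !linearP coeffD coeffZ scalerDl -scalerA.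
have [c ->] := eP x.
rewrite -[LHS]/(mklin lH _) (linear_sum (mklin lH)) linear_sum.
apply: eq_bigr => i _.
rewrite !linearZ; congr (_ *: _) => /=.
rewrite -[RHS]sE /= fglift_sum.
rewrite (bigID (mem (dom (s (g (e i)))))) /= [X in _ + X]big1 ?addr0; last first.
  by move=> z /coeff_outdom ->; rewrite scale0r.
rewrite -big_filter; apply: perm_big; apply: uniq_perm.
- by rewrite filter_uniq // undup_uniq.
- exact: uniq_dom.
move=> z; rewrite mem_filter mem_undup.
case: (boolP (z \in dom _)) => //= zd; apply/flattenP.
by exists (dom (s (g (e i)))) => //; apply: map_f; rewrite mem_enum.
Qed.

End InjDim.

Section Approximation.
Variables (R : comPzRingType) (A : nzRingType) (phi : {rmorphism R -> A}).
Hypothesis artR : artinian R.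
Hypothesis fgA : fin_gen (restrict phi (A^o : lmodType A)).
Hypothesis phiC : forall a b, phi a * b = b * phi a.

(** Evaluation on generators of M embeds Hom(M, A) as an R-submodule of A^m, so it is finitely
    generated over R; such generators are the components of [j]. Centrality of [phi] makes the
    R-multiples of a linear form linear. *)
Lemma free_left_approx (M : lmodType A) : fin_gen M ->
  exists (k : nat) (j : {linear M -> 'rV[A]_k}),
    forall f : {linear M -> (A^o : lmodType A)},
    exists h : {linear 'rV[A]_k -> (A^o : lmodType A)}, forall x, h (j x) = f x.
Proof.
move=> /fin_genP[m [q sq]].
pose ev (f : {linear M -> (A^o : lmodType A)}) : 'rV[A]_m := \row_i (f (q (delta_mx 0 i)) : A).
have evP f g : ev f = ev g -> forall x, f x = g x.
  move=> e x; have [y <-] := sq x; rewrite (row_linE q) !linear_sum.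
  apply: eq_bigr => i _; rewrite !linearZ; congr (_ *: _).
  by have := congr1 (fun v : 'rV[A]_m => v 0 i) e; rewrite !mxE.
have scl (a : R) (f : {linear M -> (A^o : lmodType A)}) :
    linear (fun x => phi a * f x : A^o).
  by move=> b x y; rewrite linearP mulrDr; congr (_ + _); rewrite /GRing.scale /= !mulrA phiC.
have [||s [sN sP]] := @restrict_fgsub R A phi artR fgA 'rV[A]_m (fun v => exists f, ev f = v).
- exact: fin_gen_row.
- split=> [|_ _ [f <-] [g <-]|a _ [f <-]].
  + by exists \0; apply/rowP => i; rewrite !mxE.
  + by exists (f \+ g); apply/rowP => i; rewrite !mxE.
  + by exists (mklin (scl a f)); apply/rowP => i; rewrite !mxE.
have [fs fsE] : exists fs : 'I_(size s) -> {linear M -> (A^o : lmodType A)},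
    forall i : 'I_(size s), ev (fs i) = s`_i.
  apply: (@fin_all_exists _ _ (fun (i : 'I_(size s)) f => ev f = s`_i)) => i.
  by apply: sN; apply: mem_nth.
have lj : linear (fun x => \row_i (fs i x : A)).
  by move=> a x y; apply/rowP => i; rewrite !mxE linearP.
exists (size s), (mklin lj) => f.
have /spanP[c cE] := sP (ev f) (ex_intro _ f erefl).
have lh : linear (fun y : 'rV[A]_(size s) => \sum_i phi (c i) * y 0 i : A^o).
  move=> a x y; rewrite scaler_sumr -big_split; apply: eq_bigr => i _.
  by rewrite !mxE mulrDr /GRing.scale /= !mulrA phiC.
exists (mklin lh); apply: (evP (mklin lh \o mklin lj) f).
apply/rowP => l; rewrite cE !mxE summxE /=; apply: eq_bigr => i _.
by rewrite -fsE !mxE.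
Qed.

End Approximation.


(** * Gorenstein projective modules *)

Section GorensteinProjective.
Variable A : nzRingType.

Definition GP (M : lmodType A) : Prop :=
  fin_gen M /\ forall k, ext k M (A^o : lmodType A).

Definition kernels_fg : Prop :=
  forall (U V : lmodType A) (f : {linear U -> V}), fin_gen U -> fin_gen (kermod f).

Lemma GP_bij (M N : lmodType A) (f : {linear M -> N}) : bijective f -> GP N -> GP M.
Proof.
by move=> bf [fN eN]; split=> [|k]; [apply: fin_gen_bijr fN | apply: ext_bij (eN k)]; apply: bf.
Qed.

Lemma GP_fgproj Q : fin_gen Q -> projective Q -> GP Q.
Proof. by move=> fQ pQ; split=> // k; apply: ext_proj. Qed.

Lemma fin_gen_ses (K B W : lmodType A) (i : {linear K -> B}) (p : {linear B -> W}) :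
  kernels_fg -> ses i p -> fin_gen B -> fin_gen K.
Proof.
move=> kfg [ii ip sp] fB.
have [|h hE] := @exact_factor A K B W (kermod p) i p (@ker_incl _ _ _ p) ii ip.
  exact: ker_incl0.
apply: (@fin_gen_surj A (kermod p) K h); last exact: kfg.
move=> x; have /(ker_incl_exact p)[y yE] : p (i x) = 0 by apply/ip; exists x.
by exists y; apply: ii; rewrite hE yE.
Qed.

Lemma GP_ker (K B W : lmodType A) (i : {linear K -> B}) (p : {linear B -> W}) :
  kernels_fg -> ses i p -> GP B -> GP W -> GP K.
Proof.
move=> kfg si [fB eB] [fW eW]; split=> [|k]; first exact: fin_gen_ses si fB.
exact: ext_left si (eB k) (eW k.+1).
Qed.

Lemma GP_mid (K B W : lmodType A) (i : {linear K -> B}) (p : {linear B -> W}) :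
  ses i p -> GP K -> GP W -> GP B.
Proof.
move=> si [fK eK] [fW eW]; split=> [|k]; first exact: fin_gen_ext si fK fW.
exact: ext_mid si (eK k) (eW k).
Qed.

End GorensteinProjective.

(** * Duality between free left and free right modules *)

Section Duality.
Variable L : nzRingType.
Local Notation Lr := (L^c^o : lmodType L^c).
Local Notation Ll := (L^o : lmodType L).

(** The evaluation pairing, left linear in [u] and right linear in [x]. It identifies free right and
    free left modules with each other's duals, so that the dual of N can be taken as the kernel of
    the transpose [dual d] of a presentation [d] of N. *)
Definition pairing m (u : 'rV[L]_m) (x : 'rV[L^c]_m) : L :=
  \sum_i (u 0 i : L) * (x 0 i : L).

Lemma pairing_linearr m (u : 'rV[L]_m) : linear (pairing u : 'rV[L^c]_m -> Lr).
Proof.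
move=> a x y; rewrite /pairing scaler_sumr -big_split; apply: eq_bigr => i _.
by rewrite !mxE mulrDr; congr (_ + _); apply: (@mulrA L (u 0 i) (x 0 i) a).
Qed.

Lemma pairing_linearl m (x : 'rV[L^c]_m) : linear ((fun u => pairing u x) : 'rV[L]_m -> Ll).
Proof.
move=> a u v; rewrite /pairing scaler_sumr -big_split; apply: eq_bigr => i _.
by rewrite !mxE mulrDl /GRing.scale /= mulrA.
Qed.

Lemma pairing0r m (u : 'rV[L]_m) : pairing u 0 = 0.
Proof. exact: (linear0 (mklin (pairing_linearr u))). Qed.

Lemma pairing0l m (x : 'rV[L^c]_m) : pairing 0 x = 0.
Proof. exact: (linear0 (mklin (pairing_linearl x))). Qed.

Lemma functional_right m (f : {linear 'rV[L^c]_m -> Lr}) :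
  exists u, forall x, f x = pairing u x.
Proof.
exists (\row_i (f (delta_mx 0 i) : L)) => x; rewrite (row_linE f) /pairing.
by apply: eq_bigr => i _; rewrite mxE.
Qed.

Lemma functional_left m (f : {linear 'rV[L]_m -> Ll}) :
  exists x, forall u, f u = pairing u x.
Proof.
exists (\row_i (f (delta_mx 0 i) : L^c)) => u; rewrite (row_linE f) /pairing.
by apply: eq_bigr => i _; rewrite mxE.
Qed.

Lemma pairing_eql m (u v : 'rV[L]_m) :
  (forall x, pairing u x = pairing v x) -> u = v.
Proof.
move=> e; apply/rowP => i.
suff pE w : pairing w (delta_mx 0 i) = w 0 i by rewrite -!pE e.
rewrite /pairing (bigD1 i) //= big1 ?addr0 => [|j ji].
  by rewrite mxE !eqxx; apply: mulr1.
by rewrite mxE (negPf ji) andbF; apply: mulr0.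
Qed.

Lemma pairing_eqr m (x y : 'rV[L^c]_m) :
  (forall u, pairing u x = pairing u y) -> x = y.
Proof.
move=> e; apply/rowP => i.
suff pE w : pairing (delta_mx 0 i) w = w 0 i by rewrite -!pE e.
rewrite /pairing (bigD1 i) //= big1 ?addr0 => [|j ji].
  by rewrite mxE !eqxx mul1r.
by rewrite mxE (negPf ji) andbF mul0r.
Qed.

Section Dual.
Variables (m l : nat) (d : {linear 'rV[L^c]_l -> 'rV[L^c]_m}).

Definition dual_fun (u : 'rV[L]_m) : 'rV[L]_l :=
  \row_i pairing u (d (delta_mx 0 i)).

Lemma dual_linear : linear dual_fun.
Proof.
by move=> a u v; apply/rowP => i; rewrite !mxE (pairing_linearl (d (delta_mx 0 i)) a u v).
Qed.

Definition dual : {linear 'rV[L]_m -> 'rV[L]_l} := mklin dual_linear.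

Lemma dualE u x : pairing (dual u) x = pairing u (d x).
Proof.
pose f : {linear 'rV[L^c]_l -> Lr} := mklin (pairing_linearr u) \o d.
rewrite -[RHS]/(f x) (row_linE f x).
by apply: eq_bigr => i _; rewrite mxE.
Qed.

End Dual.

(** The cohomology of the dualized presentation at this place is Ext^1(N, L). *)
Lemma dual_exact (N : lmodType L^c) m l k (d0 : {linear 'rV[L^c]_l -> 'rV[L^c]_m})
    (q : {linear 'rV[L^c]_m -> N}) (d1 : {linear 'rV[L^c]_k -> 'rV[L^c]_l}) :
  surjective q -> exact_at d0 q -> exact_at d1 d0 -> ext0 N Lr ->
  exact_at (dual d0) (dual d1).
Proof.
move=> sq dq dd eN u; split=> [du|[v <-]]; last first.
  apply: pairing_eql => x; rewrite !dualE.
  have -> : d0 (d1 x) = 0 by apply/dd; exists x.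
  by rewrite pairing0r pairing0l.
have d0q x : q (d0 x) = 0 by apply/dq; exists x.
have [h hE] : exists h : {linear 'rV[L^c]_m -> Lr}, forall x, h (d0 x) = pairing u x.
  have sc : surjective (ker_corestr d0q).
    move=> y; have /dq[x xE] := ker_incl0 y.
    by exists x; apply: ker_incl_inj.
  have [x|g gE] := @factor_surj _ _ _ _ (ker_corestr d0q) (mklin (pairing_linearr u)) sc.
    move/(congr1 (@ker_incl _ _ _ _)) => /= /dd[y <-].
    by rewrite -dualE du pairing0l.
  have [h hE] := eN _ _ _ _ (ses_ker sq) g.
  by exists h => x; rewrite -[RHS]gE -hE.
have [v vE] := functional_right h; exists v; apply: pairing_eql => x.
by rewrite dualE -vE hE.
Qed.

Hypothesis kfg : kernels_fg L^c.

Lemma fg_presentation (N : lmodType L^c) m (q : {linear 'rV[L^c]_m -> N}) :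
  exists l (d : {linear 'rV[L^c]_l -> 'rV[L^c]_m}), exact_at d q.
Proof.
have /fin_genP[l [p sp]] := kfg q (fin_gen_row _ m).
exists l, (@ker_incl _ _ _ q \o p) => y; rewrite ker_incl_exact.
split=> [[x <-]|[x <-]]; last by exists (p x).
by have [z <-] := sp x; exists z.
Qed.

Lemma GP_syzygy (N : lmodType L^c) m (q : {linear 'rV[L^c]_m -> N}) :
  surjective q -> GP N -> GP (kermod q).
Proof.
move=> sq; apply: GP_ker kfg (ses_ker sq) _.
exact: GP_fgproj (fin_gen_row _ m) (@projective_row _ m).
Qed.

Lemma dual_ses (N : lmodType L^c) m l k (d0 : {linear 'rV[L^c]_l -> 'rV[L^c]_m})
    (q : {linear 'rV[L^c]_m -> N}) (d1 : {linear 'rV[L^c]_k -> 'rV[L^c]_l}) :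
  surjective q -> exact_at d0 q -> exact_at d1 d0 -> ext0 N Lr ->
  exists p : {linear 'rV[L]_m -> kermod (dual d1)},
    ses (@ker_incl _ _ _ (dual d0)) p /\ forall u, ker_incl (p u) = dual d0 u.
Proof.
move=> sq dq dd eN; have de := dual_exact sq dq dd eN.
have [u|p pE] := @exact_factor _ _ _ _ _ _ (dual d1) (dual d0)
  (@ker_incl_inj _ _ _ (dual d1)) (@ker_incl_exact _ _ _ (dual d1)).
  by apply/de; exists u.
exists p; split=> //; split; first exact: ker_incl_inj.
- move=> u; rewrite -ker_incl_exact -pE; split=> [->|e]; first by rewrite linear0.
  by apply: (@ker_incl_inj _ _ _ (dual d1)); rewrite e linear0.
- move=> y; have /de[u uE] := ker_incl0 y; exists u.
  by apply: ker_incl_inj; rewrite -uE -pE.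
Qed.

Hypothesis injL : finite_injdim Ll.

(* The dual of N is, up to shifting, an arbitrarily high syzygy: dual_ses gives
   0 -> N^* -> F^* -> (Omega N)^* -> 0, so the finite injective dimension of L as a
   left module kills all Ext^(>0)(N^*, L). *)
Lemma dual_ext k (N : lmodType L^c) m l (d : {linear 'rV[L^c]_l -> 'rV[L^c]_m})
    (q : {linear 'rV[L^c]_m -> N}) :
  surjective q -> exact_at d q -> GP N -> ext k (kermod (dual d)) Ll.
Proof.
have [e eP] := finite_injdim_ext injL.
(* Here t bounds how far the degree is below [e]; replacing N by its syzygy raises the degree by one
   and lowers t. *)
suff S t k' : (e <= k' + t)%N -> forall (N : lmodType L^c) m l
    (d : {linear 'rV[L^c]_l -> 'rV[L^c]_m}) (q : {linear 'rV[L^c]_m -> N}),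
    surjective q -> exact_at d q -> GP N -> ext k' (kermod (dual d)) Ll.
  by apply: (S e); apply: leq_addl.
elim: t k' => [|t IH] k' ek {}N {}m {}l {}d {}q sq dq gN.
  by apply: eP; rewrite addn0 in ek.
have [_ eN] := gN.
have d0 x : q (d x) = 0 by apply/dq; exists x.
have sc : surjective (ker_corestr d0).
  move=> y; have /dq[x xE] := ker_incl0 y.
  by exists x; apply: ker_incl_inj.
have [r [d1 d1e]] := fg_presentation (ker_corestr d0).
have dd : exact_at d1 d.
  move=> y; rewrite -d1e; split=> [e0|]; first exact: ker_incl_inj.
  by move/(congr1 (@ker_incl _ _ _ _)).
have [p [sp _]] := dual_ses sq dq dd (eN 0%N).
apply: ext_left sp (ext_proj _ _ (@projective_row _ m)) _.
apply: IH sc d1e (GP_syzygy sq gN).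
by rewrite addSnnS.
Qed.

(* An element of F_0 on which all of M^* vanishes defines a functional on
   F_0^* / M^* = (Omega M)^*, which extends to F_1^* and is thus evaluation at an
   element of F_1; hence the given element is a boundary. *)
Lemma GP_torsionless (M : lmodType L^c) (x : M) : GP M ->
  (forall f : {linear M -> Lr}, f x = 0) -> x = 0.
Proof.
move=> gM; have [/fin_genP[m [q sq]] eM] := gM.
have [y <-] := sq x => fy.
have [l [d dq]] := fg_presentation q.
have gK := GP_syzygy sq gM.
have d0 x' : q (d x') = 0 by apply/dq; exists x'.
have sc : surjective (ker_corestr d0).
  move=> z; have /dq[x' xE] := ker_incl0 z.
  by exists x'; apply: ker_incl_inj.
have [r [d1 d1e]] := fg_presentation (ker_corestr d0).
have dd : exact_at d1 d.
  move=> z; rewrite -d1e; split=> [e0|]; first exact: ker_incl_inj.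
  by move/(congr1 (@ker_incl _ _ _ _)).
have gK2 := GP_syzygy sc gK.
have d10 x' : ker_corestr d0 (d1 x') = 0 by apply/d1e; exists x'.
have sc1 : surjective (ker_corestr d10).
  move=> z; have /d1e[x' xE] := ker_incl0 z.
  by exists x'; apply: ker_incl_inj.
have [r' [d2 d2e]] := fg_presentation (ker_corestr d10).
have dd1 : exact_at d2 d1.
  move=> z; rewrite -d2e; split=> [e0|]; first exact: ker_incl_inj.
  by move/(congr1 (@ker_incl _ _ _ _)).
have [p [sp pE]] := dual_ses sq dq dd (eM 0%N).
have [p1 [sp1 _]] := dual_ses sc d1e dd1 (gK.2 0%N).
have e2 : ext 0 (kermod (dual d2)) Ll := dual_ext 0 sc1 d2e gK2.
pose fy' : {linear 'rV[L]_m -> Ll} := mklin (pairing_linearl y).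
have [_ ep sp'] := sp.
have [u|g gE] := @exact_cofactor _ _ _ _ _ _ p fy' ep sp'.
  have [z|h hE] := @exact_cofactor _ _ _ _ _ d q (mklin (pairing_linearr (ker_incl u))) dq sq.
    by rewrite /= -dualE (ker_incl0 u) pairing0l.
  by have := fy h; rewrite [LHS](hE y).
have [h hE] := e2 _ _ _ _ sp1 g.
have [z zE] := functional_left h.
suff -> : y = d z by apply: d0.
apply: pairing_eqr => u; rewrite -dualE -zE -[LHS]/(fy' u) -gE -hE.
by congr (h _); rewrite -pE.
Qed.

End Duality.


(** * Long exact sequences as chains of short ones *)

Section Chains.
Variable A : nzRingType.
Implicit Types (B C D E F K M N Q S T U V W X Y Z : lmodType A) (P : lmodType A -> Prop).

Record link Y W := Link {
  mid : lmodType A;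
  li : {linear Y -> mid};
  lp : {linear mid -> W};
  lses : ses li lp
}.

(* [chain k Y X] is the type of exact sequences 0 -> Y -> B_1 -> ... -> B_k ->
   X -> 0, cut into short exact sequences; for k = 0 this is an isomorphism. *)
Fixpoint chain (k : nat) Y X : Type :=
  match k with
  | 0 => {f : {linear Y -> X} | bijective f}
  | l.+1 => {W : lmodType A & (link Y W * chain l W X)%type}
  end.

Definition cnil Y X (f : {linear Y -> X}) (bf : bijective f) : chain 0 Y X :=
  exist _ f bf.

Definition ccons k Y W X (l : link Y W) (c : chain k W X) : chain k.+1 Y X :=
  existT (fun W => (link Y W * chain k W X)%type) W (l, c).

Fixpoint cterms P k Y X : chain k Y X -> Prop :=
  match k return chain k Y X -> Prop with
  | 0 => fun _ => True
  | l.+1 => fun c => P (mid (projT2 c).1) /\ cterms P (projT2 c).2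
  end.

(** For positive k these are the cycles after [Y], the last of them being isomorphic to [X]. *)
Fixpoint ccycles P k Y X : chain k Y X -> Prop :=
  match k return chain k Y X -> Prop with
  | 0 => fun _ => True
  | l.+1 => fun c => P (projT1 c) /\ ccycles P (projT2 c).2
  end.

Fixpoint cmor k Y X Y' X' : chain k Y X -> chain k Y' X' ->
    {linear Y -> Y'} -> {linear X -> X'} -> Prop :=
  match k return chain k Y X -> chain k Y' X' ->
      {linear Y -> Y'} -> {linear X -> X'} -> Prop with
  | 0 => fun c c' f g => forall x, g (sval c x) = sval c' (f x)
  | l.+1 => fun c c' f g =>
      exists (b : {linear mid (projT2 c).1 -> mid (projT2 c').1})
             (w : {linear projT1 c -> projT1 c'}),
      [/\ forall x, b (li (projT2 c).1 x) = li (projT2 c').1 (f x),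
          forall x, w (lp (projT2 c).1 x) = lp (projT2 c').1 (b x)
        & cmor (projT2 c).2 (projT2 c').2 w g]
  end.

Lemma cterms_mono P P' k Y X (c : chain k Y X) :
  (forall M, P M -> P' M) -> cterms P c -> cterms P' c.
Proof.
move=> PP; elim: k Y c => [//|k IH] Y [W [l c]] /= [Pl Pc].
by split; [apply: PP | apply: IH].
Qed.

Lemma cmor_eq k Y X Y' X' (c : chain k Y X) (c' : chain k Y' X')
    (f f' : {linear Y -> Y'}) (g g' : {linear X -> X'}) :
  f =1 f' -> g =1 g' -> cmor c c' f g -> cmor c c' f' g'.
Proof.
move=> ef eg; elim: k Y Y' c c' f f' ef => [|k IH] Y Y' c c' f f' ef.
  by move=> /= e x; rewrite -eg -ef.
move=> [b [w [e1 e2 m]]]; exists b, w; split=> // [x|]; first by rewrite -ef.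
exact: IH m.
Qed.

Lemma cmor_comp k Y X Y' X' Y'' X'' (c : chain k Y X) (c' : chain k Y' X')
    (c'' : chain k Y'' X'') (f : {linear Y -> Y'}) (g : {linear X -> X'})
    (f' : {linear Y' -> Y''}) (g' : {linear X' -> X''}) :
  cmor c c' f g -> cmor c' c'' f' g' -> cmor c c'' (f' \o f) (g' \o g).
Proof.
elim: k Y Y' Y'' c c' c'' f f' => [|k IH] Y Y' Y'' c c' c'' f f'.
  by move=> /= e e' x; rewrite e e'.
move=> [b [w [e1 e2 m]]] [b' [w' [e1' e2' m']]].
exists (b' \o b), (w' \o w); split=> [x|x|]; last exact: IH m m'.
  by rewrite /= e1 e1'.
by rewrite /= e2 e2'.
Qed.

Lemma cmor_id k Y X (c : chain k Y X) : cmor c c idfun idfun.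
Proof. by elim: k Y c => [//|k IH] Y c; exists idfun, idfun; split. Qed.

Lemma chain_bijl k Y Y' X (c : chain k Y X) (f : {linear Y' -> Y}) : bijective f ->
  exists c' : chain k Y' X, cmor c' c f idfun /\ forall P, cterms P c -> cterms P c'.
Proof.
case: k c => [|k] c bf.
  have bc : bijective (sval c \o f) := bij_comp (svalP c) bf.
  by exists (cnil bc).
exists (ccons (Link (ses_bijl (lses (projT2 c).1) bf)) (projT2 c).2).
by split=> //=; exists idfun, idfun; split=> //; apply: cmor_id.
Qed.

Lemma chain_bijr k Y X X' (c : chain k Y X) (f : {linear X -> X'}) : bijective f ->
  exists c' : chain k Y X', forall P, cterms P c -> cterms P c'.
Proof.
move=> bf; elim: k Y c => [|k IH] Y c.
  have bc : bijective (f \o sval c) := bij_comp bf (svalP c).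
  by exists (cnil bc).
have [c' cP] := IH _ (projT2 c).2.
by exists (ccons (projT2 c).1 c') => P /= [? ?]; split=> //; apply: cP.
Qed.

Lemma idfun_bij M : bijective (idfun : M -> M).
Proof. by exists idfun. Qed.

(** Splicing at the right-hand end; for k = 0 the isomorphism given by [c] is absorbed into the
    inclusion of [l]. *)
Fixpoint crcons k Y X X' : chain k Y X -> link X X' -> chain k.+1 Y X' :=
  match k return chain k Y X -> link X X' -> chain k.+1 Y X' with
  | 0 => fun c l =>
      ccons (Link (ses_bijl (lses l) (svalP c))) (cnil (@idfun_bij X'))
  | j.+1 => fun c l => ccons (projT2 c).1 (crcons (projT2 c).2 l)
  end.

Lemma cterms_crcons P k Y X X' (c : chain k Y X) (l : link X X') :
  cterms P c -> P (mid l) -> cterms P (crcons c l).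
Proof.
elim: k Y c => [|k IH] Y c //= [Pc Pc'] Pl.
by split=> //; apply: IH.
Qed.

Lemma surj_comp U V W (f : {linear U -> V}) (g : {linear V -> W}) :
  surjective f -> surjective g -> surjective (g \o f).
Proof. by move=> sf sg w; have [v <-] := sg w; have [u <-] := sf v; exists u. Qed.

(** Built from the right: since each term of [T] is projective, its map onto the next cycle lifts to
    the cycle already built, and the middle term is the product. The predicates in the conclusion
    transport any property from the factors to the product. *)
Lemma horseshoe k Y' L K Z Y (S : chain k Y' L) (T : chain k Y Z)
    (i : {linear L -> K}) (p : {linear K -> Z}) :
  ses i p -> cterms (@projective A) T ->
  exists Y'' (R : chain k Y'' K) (j : {linear Y' -> Y''}) (q : {linear Y'' -> Y}),
    [/\ ses j q, cmor R T q p &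
      forall P1 P2 P3 : lmodType A -> Prop,
        (forall M N, P1 M -> P2 N -> P3 (M * N)%type) ->
        cterms P1 S -> cterms P2 T -> cterms P3 R].
Proof.
elim: k Y Y' S T => [|k IH] Y Y' S T si pT.
  have [t [tK Kt]] := bij_linv (svalP T).
  exists K, (cnil (@idfun_bij K)), (i \o sval S), (t \o p); split=> //.
  - apply: ses_bijr; last by exists (sval T).
    exact: ses_bijl si (svalP S).
  - by move=> x; rewrite /= Kt.
case: S => W' [[M iS pS sS] S']; case: T pT => W [[Q iT pT sT] T'] /= [pQ pT'].
have [W'' [R [j [q [sj m Pm]]]]] := IH W W' S' T' si pT'.
have [iS_ eS sS_] := sS; have [iT_ eT sT_] := sT; have [ij ej sj_] := sj.
have [s sE] := pQ _ _ q pT sj_.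
pose f : {linear (M * Q)%type -> W''} := ((j \o pS) \o fst) \+ (s \o snd).
have fE m' x : f (m', x) = j (pS m') + s x by [].
have qf m' x : q (f (m', x)) = pT x.
  by rewrite fE linearD (ses_comp0 _ sj) add0r sE.
have fs : surjective f.
  move=> w; have [x xE] := sT_ (q w).
  have /ej[w' wE] : q (w - s x) = 0 by rewrite linearB sE xE subrr.
  by have [m' mE] := sS_ w'; exists (m', x); rewrite fE mE wE subrK.
have l1 : linear (fun y => (iS y, 0) : (M * Q)%type).
  by move=> a x y; rewrite linearP; apply: injective_projections; rewrite /= ?scaler0 ?addr0.
have [y|g gE] := @exact_factor _ _ _ _ _ _ f (mklin l1)
    (@ker_incl_inj _ _ _ f) (@ker_incl_exact _ _ _ f).
  by rewrite -[mklin l1 y]/((iS y, 0) : (M * Q)%type) fE (ses_comp0 _ sS) !linear0 addr0.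
pose sndk : {linear kermod f -> Q} := snd \o @ker_incl _ _ _ f.
have sndE y : sndk y = (ker_incl y).2 by [].
have [y|h hE] := @exact_factor _ _ _ _ _ _ pT sndk iT_ eT.
  rewrite sndE; have := ker_incl0 y; case: (ker_incl y) => m' x e.
  by rewrite -[(m', x).2]/x -(qf m') e linear0.
exists (kermod f), (ccons (Link (ses_ker fs)) R), g, h; split.
- split.
  + move=> x y e; apply: iS_; have := gE x; rewrite e gE.
    by case.
  + move=> y; split=> [hy|[x <-]]; last first.
      by apply: iT_; rewrite hE sndE gE linear0.
    have y2 : (ker_incl y).2 = 0 by rewrite -sndE -hE hy linear0.
    have := ker_incl0 y; case yE : (ker_incl y) y2 => [m' x] x0; rewrite [x]x0 in yE *.
    rewrite fE linear0 addr0 -[X in _ = X](linear0 j) => /ij/eS[u uE].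
    by exists u; apply: (@ker_incl_inj _ _ _ f); rewrite gE [RHS]yE -uE.
  + move=> y; have /ej[w' wE] : q (s (iT y)) = 0 by rewrite sE (ses_comp0 _ sT).
    have [m' mE] := sS_ w'.
    have /(ker_incl_exact f)[z zE] : f (- m', iT y) = 0.
      by rewrite fE !linearN mE wE addNr.
    by exists z; apply: iT_; rewrite hE sndE zE.
- exists snd, q; split=> //.
  by move=> [m' x]; rewrite qf.
- move=> P1 P2 P3 P3P /= [P1M P1S] [P2Q P2T]; split; first exact: P3P.
  exact: Pm P1S P2T.
Qed.

End Chains.


(** * Comparison, pullback and syzygies of chains *)

Section ChainConstructions.
Variable A : nzRingType.
Implicit Types (B C D E F K M N Q S T U V W X Y Z : lmodType A) (P : lmodType A -> Prop).

Definition fgproj Q : Prop := fin_gen Q /\ projective Q.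

Lemma fgproj_prod M N : fgproj M -> fgproj N -> fgproj (M * N)%type.
Proof.
by move=> [fM pM] [fN pN]; split; [apply: fin_gen_prod | apply: projective_prod].
Qed.

Lemma fgproj_zmod : fgproj (zmod A).
Proof. by split; [apply: fin_gen_zmod | apply: projective_zmod]. Qed.

Lemma fg_cover X : fin_gen X -> exists Q (p : {linear Q -> X}), fgproj Q /\ surjective p.
Proof.
move=> /fin_genP[m [p sp]]; exists 'rV[A]_m, p; split=> //.
by split; [apply: fin_gen_row | apply: projective_row].
Qed.

(** Only the last term changes, to its pullback along [g]. By the universal property every morphism
    into [c] over [g] factors through [c'] over the identity of X; this is how different extensions
    are later compared. *)
Lemma pullback_chain k W X Z (c : chain k.+1 W Z) (g : {linear X -> Z}) :
  exists c' : chain k.+1 W X,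
  [/\ cmor c' c idfun g,
      forall K (d : chain k.+1 K X) (f : {linear K -> W}),
        cmor d c f g -> cmor d c' f idfun
    & forall P1 P2, cterms P1 c -> (forall M, P1 M -> P2 M) ->
        (forall M (p : {linear M -> Z}), surjective p -> P1 M -> P2 (pullback p g)) ->
        cterms P2 c'].
Proof.
elim: k W c => [|k IH] W [W2 [[Q i p s] c]] /=.
  pose u : {linear Q -> Z} := sval c \o p.
  have su : ses i u := ses_bijr s (svalP c).
  have [j [sj jE]] := pb_ses_snd g su.
  have [_ ep sp] := sj.
  exists (ccons (Link sj) (cnil (@idfun_bij _ X))); split.
  - have [x|w wE] := @exact_cofactor _ _ _ _ _ j (pb_snd u g) (p \o pb_fst u g) ep sp.
      by rewrite /= jE (ses_comp0 _ s).
    exists (pb_fst u g), w; split=> // x /=.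
    have [y <-] := sp x.
    by rewrite -pb_comm wE.
  - move=> K [K2 [[B iB pB sB] d]] f /= [b [w [e1 e2 m]]].
    have [x|h [h1 h2]] := @pb_lift _ _ _ _ u g B b (sval d \o pB).
      by rewrite /= -e2 m.
    exists h, (sval d); split=> // x.
      apply: pb_inj; first by rewrite h1 jE e1.
      by rewrite h2 /= (ses_comp0 _ sB) linear0 (ses_comp0 _ sj).
  - move=> P1 P2 /= [P1Q _] P12 Ppb; split=> //; apply: Ppb => //.
    by have [] := su.
have [c' [m lft Pc']] := IH _ c.
exists (ccons (Link s) c'); split.
- by exists idfun, idfun.
- move=> K [K2 [[B iB pB sB] d]] f [b [w [e1 e2 m']]].
  by exists b, w; split=> //; apply: lft.
- move=> P1 P2 /= [P1Q P1c] P12 Ppb; split; first exact: P12.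
  exact: Pc' P1c P12 Ppb.
Qed.

(** The comparison theorem from left to right: vanishing of Ext^1 from the cycles of [c] to the
    terms of [d] allows each map to be extended to the next term. *)
Lemma cmor_extend k K X W Z (c : chain k K X) (d : chain k W Z)
    (f : {linear K -> W}) P P' :
  (forall M Q, P M -> P' Q -> ext0 M Q) -> ccycles P c -> cterms P' d ->
  exists g, cmor c d f g.
Proof.
move=> PP'; elim: k K W c d f => [|k IH] K W c d f.
  have [t [tK Kt]] := bij_linv (svalP c) => _ _.
  by exists (sval d \o (f \o t)) => x /=; rewrite tK.
case: c => K2 [[B iB pB sB] c]; case: d => W2 [[Q iQ pQ sQ] d].
move=> [/= PK2 Pc] [/= PQ Pd].
have [b bE] := PP' _ _ PK2 PQ _ _ _ _ sB (iQ \o f).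
have [_ eB sB'] := sB.
have [x|w wE] := @exact_cofactor _ _ _ _ _ iB pB (pQ \o b) eB sB'.
  by rewrite /= bE (ses_comp0 _ sQ).
have [g m] := IH _ _ c d w Pc Pd.
by exists g, b, w; split.
Qed.

Lemma chain_left_fg k Y X (c : chain k Y X) : kernels_fg A ->
  fin_gen X -> cterms (@fin_gen A) c -> fin_gen Y.
Proof.
case: k c => [|k] c kfg fX; first by move=> _; apply: fin_gen_bijr (svalP c) fX.
by move=> [fB _]; apply: fin_gen_ses kfg (lses (projT2 c).1) fB.
Qed.

Lemma proj_chain k W X (c : chain k W X) : kernels_fg A -> GP X ->
  exists K (d : chain k K X) (u : {linear K -> W}),
    [/\ cmor d c u idfun, cterms fgproj d, ccycles (@GP A) d & GP K].
Proof.
move=> kfg gX; elim: k W c => [|k IH] W c.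
  have [t [tK Kt]] := bij_linv (svalP c).
  exists X, (cnil (@idfun_bij _ X)), t; split=> // x.
case: c => W2 [[B i p s] c].
have [K2 [d [u [m Pd Gd gK2]]]] := IH _ c.
have [Q [q [fQ sq]]] := fg_cover gK2.1.
have [is_ ep sp] := s.
have [b bE] := fQ.2 _ _ p (u \o q) sp.
have [x|v vE] := @exact_factor _ _ _ _ _ i p (b \o @ker_incl _ _ _ q) is_ ep.
  by rewrite /= bE /= (ker_incl0 x) linear0.
exists (kermod q), (ccons (Link (ses_ker sq)) d), v; split=> //.
  by exists b, u; split.
exact: GP_ker kfg (ses_ker sq) (GP_fgproj fQ.1 fQ.2) gK2.
Qed.

(** Compare a projective resolution of X with the tail of [c], and pull the first short exact
    sequence back along the resulting map of cycles. The class is unchanged, and all cycles after Y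
    become Gorenstein projective, as [cmor_extend] will require. *)
Lemma proj_extension k Y X (c : chain k.+1 Y X) : kernels_fg A -> GP X ->
  fin_gen Y -> exists d : chain k.+1 Y X,
    [/\ cmor d c idfun idfun, cterms (@fin_gen A) d & ccycles (@GP A) d].
Proof.
move=> kfg gX fY; case: c => W [[B i p s] c].
have [K [d [u [m Pd Gd gK]]]] := proj_chain c kfg gX.
have [j [sj jE]] := pb_ses_snd u s.
exists (ccons (Link sj) d); split=> //=.
- exists (pb_fst p u), u; split=> //= x.
  by rewrite pb_comm.
- split; first exact: fin_gen_ext sj fY gK.1.
  by apply: cterms_mono Pd => M [].
Qed.

Lemma chain_ext (k N : nat) Y X (c : chain N Y X) Z : cterms (@projective A) c ->
  ext (k + N) X Z -> ext k Y Z.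
Proof.
elim: N k Y c => [|N IH] k Y c.
  by rewrite addn0 => _; apply: ext_bij (svalP c).
case: c => W [[Q i p s] c] /= [pQ pc] eX.
apply: ext_left s (ext_proj _ _ pQ) _.
by apply: IH pc _; rewrite addSnnS.
Qed.

Lemma chain_ext2 (k N : nat) Y X (c : chain N Y X) Z :
  cterms (fun Q => forall k, ext k Z Q) c ->
  ext (k + N) Z Y -> ext k Z X.
Proof.
elim: N k Y c => [|N IH] k Y c.
  have [t [tK Kt]] := bij_linv (svalP c).
  by rewrite addn0 => _; apply: (@ext_bij2 _ _ _ _ _ t); exists (sval c).
case: c => W [[Q i p s] c] /= [pQ pc] eX.
apply: IH pc _; apply: ext_right2 s (pQ _) _.
by rewrite -addnS.
Qed.

Lemma syzygy_chain (N : nat) X : kernels_fg A -> fin_gen X ->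
  exists K (c : chain N K X), cterms fgproj c.
Proof.
move=> kfg fX; elim: N => [|N [K [c Pc]]].
  by exists X, (cnil (@idfun_bij _ X)).
have fK : fin_gen K.
  by apply: (chain_left_fg kfg fX (c := c)); apply: cterms_mono Pc => M [].
have [Q [q [fQ sq]]] := fg_cover fK.
by exists (kermod q), (ccons (Link (ses_ker sq)) c).
Qed.

(** The horseshoe lemma is applied to each short exact sequence of [c]. The syzygies of the two ends
    are prescribed, those of the cycles in between are chosen. *)
Lemma resolve_syzygy P (N m : nat) W X (c : chain m.+1 W X) :
  kernels_fg A -> cterms (fun M => P M /\ fin_gen M) c ->
  forall W' K, (exists t : chain N W' W, cterms fgproj t) ->
  (exists t : chain N K X, cterms fgproj t) ->
  exists c' : chain m.+1 W' K,
    cterms (fun M => exists D (t : chain N M D), P D /\ cterms fgproj t) c'.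
Proof.
move=> kfg; elim: m W c => [|m IH] W [W2 [[B i p s] c]] /=.
  move=> [[PB fB] _] W' K [t' Pt'] [t Pt].
  have [r [rK Kr]] := bij_linv (svalP c).
  have [|T PT] := chain_bijr t (f := r); first by exists (sval c).
  have := PT _ Pt => {}PT.
  have [|B' [R [j [q [sj _ PR]]]]] := @horseshoe A _ _ _ _ _ _ t' T _ _ s.
    by apply: cterms_mono PT => M [].
  exists (ccons (Link sj) (cnil (@idfun_bij _ K))); split=> //=.
  by exists B, R; split=> //; apply: PR Pt' PT; apply: fgproj_prod.
move=> [[PB fB] Pc] W' K [t' Pt'] tK.
have fW2 : fin_gen W2 by have [_ _ sp] := s; apply: fin_gen_surj sp fB.
have [W2' [t2 Pt2]] := @syzygy_chain N W2 kfg fW2.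
have [c' Pc'] := IH W2 c Pc W2' K (ex_intro _ t2 Pt2) tK.
have [|B' [R [j [q [sj _ PR]]]]] := @horseshoe A _ _ _ _ _ _ t' t2 _ _ s.
  by apply: cterms_mono Pt2 => M [].
exists (ccons (Link sj) c'); split=> //=.
by exists B, R; split=> //; apply: PR Pt' Pt2; apply: fgproj_prod.
Qed.

End ChainConstructions.


(** * Chains as sequences and extensions, and exactness of Hom on them *)

Section ChainSequences.
Variable A : nzRingType.
Implicit Types (B C D E F K M N Q S T U V W X Y Z : lmodType A) (P : lmodType A -> Prop).

(** The terms after [Y]. The value is [X] from index k on, because an [mseq] has a term for every
    natural number. *)
Fixpoint inner k Y X : chain k Y X -> nat -> lmodType A :=
  match k return chain k Y X -> nat -> lmodType A with
  | 0 => fun _ _ => X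
  | l.+1 => fun c j =>
      if j is j'.+1 then inner (projT2 c).2 j' else mid (projT2 c).1
  end.

Definition head_map k Y X : forall c : chain k Y X, {linear Y -> inner c 0} :=
  match k return forall c : chain k Y X, {linear Y -> inner c 0} with
  | 0 => fun c => sval c
  | l.+1 => fun c => li (projT2 c).1
  end.

Fixpoint step_map k Y X :
    forall (c : chain k Y X) j, {linear inner c j -> inner c j.+1} :=
  match k return
    forall (c : chain k Y X) j, {linear inner c j -> inner c j.+1} with
  | 0 => fun c j => idfun
  | l.+1 => fun c j =>
      match j return {linear @inner l.+1 Y X c j -> @inner l.+1 Y X c j.+1} with
      | 0 => head_map (projT2 c).2 \o lp (projT2 c).1
      | j'.+1 => step_map (projT2 c).2 j'
      end
  end.

Fixpoint last_map k Y X : forall c : chain k Y X, {linear inner c k -> X} :=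
  match k return forall c : chain k Y X, {linear inner c k -> X} with
  | 0 => fun c => idfun
  | l.+1 => fun c => last_map (projT2 c).2
  end.

Definition chain_ob k Y X (c : chain k Y X) (j : nat) : lmodType A :=
  if j is j'.+1 then inner c j' else Y.

Definition chain_d k Y X (c : chain k Y X) (j : nat) :
    {linear chain_ob c j -> chain_ob c j.+1} :=
  match j return {linear chain_ob c j -> chain_ob c j.+1} with
  | 0 => head_map c
  | j'.+1 => step_map c j'
  end.

Definition chain_seq k Y X (c : chain k Y X) : mseq A := MSeq (chain_d c).

Lemma last_map_bij k Y X (c : chain k Y X) : bijective (last_map c).
Proof. by elim: k Y c => [|k IH] Y c; [exists idfun | apply: IH]. Qed.

Lemma chain_seq_exact k Y X (c : chain k Y X) : exact_seq k (chain_seq c).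
Proof.
elim: k Y c => [|k IH] Y c.
  by split=> //; [apply: bij_inj (svalP c) | apply: bij_surj (svalP c)].
case: c => W [[B i p s] c]; have [ii ip sp] := s.
have [ih eh sh] := IH _ c; split=> //.
- case=> [_|[|j]] => [y|jk y|jk].
  + rewrite -ip; split=> [e|py]; first by apply: ih; rewrite linear0.
    by rewrite /= py linear0.
  + split=> [/(eh 0%N jk)[w <-]|[x <-]].
      by have [x <-] := sp w; exists x.
    by apply/(eh 0%N jk); exists (p x).
  + exact: eh j.+1 jk.
- case: k c {IH ih eh} sh => [|k] c sh; last exact: sh.
  exact: surj_comp sp sh.
Qed.

Lemma chain_seq_terms P k Y X (c : chain k Y X) :
  P Y -> P X -> cterms P c -> forall j, P (chain_seq c j).
Proof.
move=> PY PX Pc [//|j]; elim: k Y c j {PY} Pc => [//|k IH] Y c [|j] [Pl Pc] //.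
exact: IH.
Qed.

Lemma cmor_seq k Y X Y' X' (c : chain k Y X) (c' : chain k Y' X')
    (f : {linear Y -> Y'}) (g : {linear X -> X'}) : cmor c c' f g ->
  exists b : forall j, {linear inner c j -> inner c' j},
    [/\ forall x, b 0%N (head_map c x) = head_map c' (f x),
        forall j x, b j.+1 (step_map c j x) = step_map c' j (b j x)
      & forall x, last_map c' (b k x) = g (last_map c x)].
Proof.
elim: k Y Y' c c' f => [|k IH] Y Y' c c' f; first by move=> m; exists (fun=> g).
case: c => W [[B i p s] c]; case: c' => W' [[B' i' p' s'] c'].
move=> /= [b [w [e1 e2 m]]]; have [h [h1 h2 h3]] := IH _ _ c c' w m.
exists (fun j => match j return {linear
    @inner k.+1 Y X (ccons (Link s) c) j -> @inner k.+1 Y' X' (ccons (Link s') c') j}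
  with 0 => b | j'.+1 => h j' end); split=> //.
case=> [|j] x /=; last exact: h2.
by rewrite h1 e2.
Qed.

Lemma seq_chain n (S : mseq A) Y X (l : {linear Y -> S 0%N}) (r : {linear S n.+1 -> X}) :
  exact_seq n S -> bijective l -> bijective r ->
  exists c : chain n Y X,
    (forall P, (forall j, (0 < j <= n)%N -> P (S j)) -> cterms P c) /\
    exists b : forall j, {linear inner c j -> S j.+1},
    [/\ forall x, b 0%N (head_map c x) = sd S 0 (l x),
        forall j x, (j < n)%N -> b j.+1 (step_map c j x) = sd S j.+1 (b j x)
      & forall x, r (b n x) = last_map c x].
Proof.
elim: n S Y l r => [|n IH] S Y l r [iS eS sS] bl br.
  have bc : bijective (r \o (sd S 0 \o l)).
    by apply: bij_comp br _; apply: bij_comp bl; apply: inj_surj_bij.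
  have [r' [rK Kr]] := bij_linv br.
  exists (cnil bc); split=> //.
  exists (fun j => match j return {linear X -> S j.+1} with 0 => r' | _ => \0 end).
  by split=> //= x; rewrite rK.
(* [kermod t] is to be the first cycle. When the old n is 0, [S 2] is the last relevant term and
   nothing is known about [sd S 2], so the zero map replaces it. *)
have [t [te t0]] : exists t : {linear S 2 -> S 3}, exact_at (sd S 1) t /\
    if n is 0 then t = \0 else t = sd S 2.
  case: n eS sS {IH r br} => [|n] eS sS; [exists \0 | exists (sd S 2)]; split=> //.
  exact: eS.
pose ob j : lmodType A := if j is j'.+1 then S j'.+2 else kermod t.
pose d j : {linear ob j -> ob j.+1} :=
  match j return {linear ob j -> ob j.+1} with
  | 0 => @ker_incl A _ _ t | j'.+1 => sd S j'.+2 end.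
pose S' := MSeq d.
have t0' x : t (sd S 1 x) = 0 by apply/te; exists x.
have S'e : exact_seq n S'.
  split; first exact: ker_incl_inj.
    case=> [|j] jn; last exact: eS.
    case: n t0 jn {IH eS sS r br} => [//|n] e _ y.
    by rewrite -[sd S' 1]/(sd S 2) -e; apply: ker_incl_exact.
  case: n t0 eS sS {IH r br} => [|n] t0 eS sS; last exact: sS.
  by move=> y; apply/(ker_incl_exact t); rewrite t0.
have s1 : ses (sd S 0 \o l) (ker_corestr t0').
  apply: ses_bijl bl; split=> //.
    move=> y; rewrite -(eS 0%N) //; split=> [/(congr1 (@ker_incl _ _ _ _)) //|e].
    exact: ker_incl_inj.
  move=> y; have /te[x xE] := ker_incl0 y.
  by exists x; apply: ker_incl_inj.
have [c [Pc [b [b1 b2 b3]]]] := IH S' (kermod t) idfun r S'e (@idfun_bij _ _) br.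
exists (ccons (Link s1) c); split=> [P PS|].
  split; first exact: PS.
  by apply: Pc => -[|j] // jn; apply: PS.
exists (fun j => match j return {linear @inner n.+1 Y X (ccons (Link s1) c) j -> S j.+1}
  with 0 => idfun | j'.+1 => b j' end); split=> //.
by case=> [|j] x jn /=; [rewrite b1 | apply: b2].
Qed.

Section ChainExtension.
Variables (n : nat) (Y X : lmodType A) (c : chain n Y X).
Hypotheses (fY : fin_gen Y) (fX : fin_gen X) (fc : cterms (@fin_gen A) c).

Definition chain_extension : extension n Y X :=
  @Extension A n Y X (chain_seq c) (fun k _ => chain_seq_terms fY fX fc k)
    (chain_seq_exact c) idfun (@idfun_bij A Y) (last_map c) (last_map_bij c).

End ChainExtension.

Lemma cmor_extension n Y X (c c' : chain n Y X) (fY fY' : fin_gen Y)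
    (fX fX' : fin_gen X) (fc : cterms (@fin_gen A) c) (fc' : cterms (@fin_gen A) c') :
  cmor c c' idfun idfun ->
  ext_morphism (chain_extension fY fX fc) (chain_extension fY' fX' fc').
Proof.
move=> /cmor_seq[b [b1 b2 b3]].
exists (fun j => match j return {linear chain_ob c j -> chain_ob c' j}
  with 0 => idfun | j'.+1 => b j' end); split=> //.
by case=> [|j] _ x; [apply: b1 | apply: b2].
Qed.

Lemma extension_chain n Y X (E : extension n Y X) (fY : fin_gen Y) (fX : fin_gen X) :
  exists (c : chain n Y X) (fc : cterms (@fin_gen A) c),
    ext_morphism (chain_extension fY fX fc) E.
Proof.
have [c [Pc [b [b1 b2 b3]]]] := seq_chain (ext_exact E) (ext_l_bij E) (ext_r_bij E).
have fc : cterms (@fin_gen A) c.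
  by apply: Pc => j /andP[_ jn]; apply: (ext_fg E); apply: leqW.
exists c, fc.
exists (fun j => match j return {linear chain_ob c j -> E j}
  with 0 => ext_l E | j'.+1 => b j' end); split=> //.
by case=> [|j] jn x; [apply: b1 | apply: b2].
Qed.

Lemma crcons_last k Y X X' (c : chain k Y X) (l : link X X') :
  exists p : {linear inner (crcons c l) k -> mid l},
    bijective p /\
    forall x, last_map (crcons c l) (step_map (crcons c l) k x) = lp l (p x).
Proof.
elim: k Y c => [|k IH] Y c; last exact: IH.
by exists idfun; split=> //; exists idfun.
Qed.

Lemma chain_seq_complex k Y X (c : chain k Y X) : is_complex k (chain_seq c).
Proof.
by move=> j jk x; have [_ e _] := chain_seq_exact c; apply/(e j jk); exists x.
Qed.

(** By dimension shifting, the next cycle satisfies the same hypothesis with one degree less, in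
    step with the shorter chain; maps into the next cycle lift to the term before it because
    Ext^1(D, W) = 0. *)
Lemma chain_hom_from n k W X (c : chain k W X) D : (k <= n)%N ->
  (forall i, (i.+1 < k)%N -> ext i D W) ->
  cterms (fun B => forall i, (i.+1 < n)%N -> ext i D B) c ->
  hom_from_exact k (chain_seq c) D.
Proof.
move=> kn; elim: k W c kn => [|k IH] W c kn eW.
  move=> _; split=> // g g0 x; apply: (bij_inj (svalP c)).
  by rewrite linear0; apply: g0.
have [ii ei _] := chain_seq_exact c.
case: c ii ei => W2 [[B i p s] c] ii ei [eB Pc].
have [i_ ip sp] := s; simpl in eB.
have [|h1 h2] := IH W2 c (ltnW kn) _ Pc.
  move=> j jk; apply: (ext_right2 s (eB _ _) (eW _ _)) => //.
  by apply: leq_trans kn; apply: leqW.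
split=> [g g0 x|].
  by apply: i_; rewrite linear0; apply: g0.
have [ih eh sh] := chain_seq_exact c.
case=> [|[|j]] jk g.
- split=> [g0|[h hE] x]; last first.
    by rewrite hE; apply: (proj2 (ei 0%N jk _)); exists (h x).
  have [|h hE] := @exact_factor A _ _ _ _ i p g i_ ip; last by exists h => x; rewrite -[LHS]hE.
  by move=> x; apply: ih; rewrite linear0; apply: g0.
- have [e1 e2] := h2 0%N jk g; split=> [/e1[h hE]|[h hE] x]; last first.
    by rewrite hE; apply: (proj2 (ei 1%N jk _)); exists (h x).
  have [|l lE] := ext0_lift h s; first exact: (eW 0%N jk).
  by exists l => x; rewrite hE -lE.
- exact: h2 j.+1 jk g.
Qed.

(** Shifting from X to W across k terms turns degree i + 1 into i + 1 + k, which must stay below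
    n. *)
Lemma chain_left_ext n k W X (c : chain k W X) Z : (k <= n)%N ->
  (forall i, (i.+1 < n)%N -> ext i X Z) ->
  cterms (fun B => forall i, (i.+1 < n)%N -> ext i B Z) c ->
  forall i, (i.+1 + k < n)%N -> ext i W Z.
Proof.
move=> kn eX; elim: k W c kn => [|k IH] W c kn.
  by move=> _ i; rewrite addn0 => ik; apply: ext_bij (svalP c) (eX _ ik).
case: c => W2 [[B i p s] c] [eB Pc] j jk.
apply: (ext_left s (eB _ _)); first by apply: leq_ltn_trans jk; apply: leq_addr.
by apply: (IH W2 c (ltnW kn) Pc); rewrite addSnnS.
Qed.

Lemma chain_head_extend n k W X (c : chain k W X) Z (g : {linear W -> Z}) :
  (k < n)%N -> (forall i, (i.+1 < n)%N -> ext i X Z) ->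
  cterms (fun B => forall i, (i.+1 < n)%N -> ext i B Z) c ->
  exists h : {linear inner c 0 -> Z}, forall x, h (head_map c x) = g x.
Proof.
case: k c => [|k] c kn eX.
  have [t [tK Kt]] := bij_linv (svalP c).
  by exists (g \o t) => x; rewrite /= tK.
case: c => W3 [[B2 i2 p2 s2] c] [eB2 Pc].
have e3 : ext 0 W3 Z.
  exact: (chain_left_ext (ltnW (ltnW kn)) eX Pc).
by have [h hE] := e3 _ _ _ _ s2 g; exists h.
Qed.

Lemma chain_hom_to n k W X (c : chain k W X) Z : (k <= n)%N ->
  (forall i, (i.+1 < n)%N -> ext i X Z) ->
  cterms (fun B => forall i, (i.+1 < n)%N -> ext i B Z) c ->
  hom_to_exact k (chain_seq c) Z.
Proof.
move=> kn eX Pc; split.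
  move=> g g0 x; have [_ _ sh] := chain_seq_exact c.
  by have [y <-] := sh x; apply: g0.
elim: k W c kn Pc => [//|k IH] W c kn Pc j jk g.
have [ii ei si] := chain_seq_exact c.
split=> [|[h hE] x]; last first.
  by rewrite hE (_ : sd _ _ _ = 0) ?linear0 //; apply: (proj2 (ei j jk _)); exists x.
case: c Pc j jk g {ii ei si} => W2 [[B i p s] c] [eB Pc] [|[|j]] jk g g0.
- have [i_ ip sp] := s.
  have [g' g'E] := exact_cofactor ip sp g0.
  have [h hE] := chain_head_extend g' kn eX Pc.
  by exists h => x; rewrite /= hE g'E.
- have [_ _ sp] := s.
  apply: (proj1 (IH W2 c (ltnW kn) Pc 0%N jk g)) => x.
  by have [y <-] := sp x; apply: g0.
- exact: (proj1 (IH W2 c (ltnW kn) Pc j.+1 jk g) g0).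
Qed.

End ChainSequences.


(** * Complete resolutions *)

Section Complexes.
Variable A : nzRingType.
Implicit Types (M N Q W X Y Z : lmodType A).

Section LinkedComplex.
Variables (Z : int -> lmodType A) (l : forall j, link (Z j) (Z (j + 1))).
Hypothesis fgl : forall j, fgproj (mid (l j)).

Definition linked_d j : {linear mid (l j) -> mid (l (j + 1))} :=
  li (l (j + 1)) \o lp (l j).

Lemma linked_d0 j x : linked_d j x = 0 <-> lp (l j) x = 0.
Proof.
have [ii _ _] := lses (l (j + 1)).
by split=> [e|/= ->]; [apply: ii; rewrite linear0 | rewrite linear0].
Qed.

Lemma linked_exact j : exact_at (linked_d j) (linked_d (j + 1)).
Proof.
have [_ e _] := lses (l (j + 1)); have [_ _ sp] := lses (l j).
move=> y; rewrite linked_d0 e; split=> [[z <-]|[x <-]]; last by exists (lp (l j) x).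
by have [x <-] := sp z; exists x.
Qed.

Definition linked_complex : fgproj_acyclic_complex A :=
  FgprojAcyclicComplex (fun j => (fgl j).1) (fun j => (fgl j).2) linked_exact.

Lemma linked_cycle j : isomorphic (Z j) (cycle linked_complex j).
Proof.
have [ii e _] := lses (l j).
have [x|h hE] := @exact_factor _ _ _ _ _ _ (linked_d j) (li (l j))
  (@ker_incl_inj _ _ _ (linked_d j)) (@ker_incl_exact _ _ _ (linked_d j)).
  by apply/linked_d0/e; exists x.
exists h; apply: inj_surj_bij => [x y exy|y].
  by apply: ii; rewrite -!hE exy.
have /linked_d0/e[x xE] := ker_incl0 y.
by exists x; apply: (@ker_incl_inj _ _ _ (linked_d j)); rewrite hE xE.
Qed.

End LinkedComplex.

Section Cycles.
Variable P : fgproj_acyclic_complex A.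

Lemma cycle_ses j : ses (@ker_incl _ _ _ (cd P j)) (to_cycle P j).
Proof.
split; first exact: ker_incl_inj.
  move=> y; rewrite -ker_incl_exact; split=> [|e]; last exact: ker_incl_inj.
  by move/(congr1 (@ker_incl _ _ _ _)).
move=> y; have /(@cd_exact _ P j)[x xE] := ker_incl0 y.
by exists x; apply: ker_incl_inj.
Qed.

Lemma fin_gen_cycle j : fin_gen (cycle P j).
Proof.
rewrite -[j](subrK 1); have [_ _ s] := cycle_ses (j - 1).
exact: fin_gen_surj s (@cob_fg _ P _).
Qed.

Lemma cycle_ext (k N : nat) a Y :
  ext k (cycle P a) Y <-> ext (k + N) (cycle P (shift a N)) Y.
Proof.
elim: N => [|N IH]; first by rewrite addn0.
by rewrite IH addnS; apply: ext_shift (cycle_ses _) (@cob_proj _ P _).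
Qed.

Lemma shiftE a (N : nat) : shift a N = a + N%:Z.
Proof.
elim: N => [|N IH]; first by rewrite addr0.
by rewrite -[shift a N.+1]/(shift a N + 1) IH intS [1 + _]addrC addrA.
Qed.

(** Z^a is a d-th syzygy of Z^(a+d), so Ext^(k+1)(Z^a, A) = Ext^(k+d+1)(Z^(a+d), A) = 0. *)
Lemma GP_cycle d a : (forall k X, (d <= k)%N -> ext k X (A^o : lmodType A)) ->
  GP (cycle P a).
Proof.
move=> injA; split=> [|k]; first exact: fin_gen_cycle.
by apply/(cycle_ext k d); apply: injA; apply: leq_addl.
Qed.

Section Segments.
Variable Q : lmodType A.
Hypothesis extQ : forall j (g : {linear cycle P j -> Q}),
  exists h : {linear P j -> Q}, forall x, h (ker_incl x) = g x.

(** The comparisons of indices with n in [seg_d] are generalized to booleans, so that the types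
    depending on them can be destructed. *)
Lemma seg_head_exact (b b' : bool) j (g : {linear seg_term P b j -> Q}) : b ->
  (forall x, g (seg_head P b j x) = 0) <->
  exists h : {linear seg_term P b' (j + 1) -> Q},
    forall x, g x = h (seg_step P b b' j x).
Proof.
case: b g => // g _; have [_ e s] := cycle_ses j; split=> [g0|[h hE] x].
  have [h hE] := exact_cofactor e s g0.
  case: b'; last by exists h => x; rewrite hE.
  have [h' h'E] := extQ h; exists h' => x.
  by rewrite -hE -h'E.
rewrite hE; suff -> : seg_step P true b' j (seg_head P true j x) = 0 by rewrite linear0.
case: b' h {hE} => h; last exact: (proj2 (e _) (ex_intro _ x erefl)).
exact: (ker_incl0 x).
Qed.

Lemma seg_step_exact (b b' : bool) j (g : {linear seg_term P b' (j + 1) -> Q}) :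
  b -> b' ->
  (forall x, g (seg_step P b b' j x) = 0) <->
  (forall x, g (seg_head P b' (j + 1) x) = 0).
Proof.
case: b => //; case: b' g => // g _ _; split=> g0 x.
  have /(@cd_exact _ P j)[y yE] := ker_incl0 x.
  by rewrite -[seg_head _ _ _ _]yE; apply: g0.
exact: (g0 (to_cycle P j x)).
Qed.

Lemma segment_hom_to_acyclic n a : (0 < n)%N ->
  hom_to_acyclic n (segment P n a) Q.
Proof.
move=> n0; split; last first.
  by rewrite /= n0 => g; have [h hE] := extQ g; exists h => x; rewrite hE.
split.
  case: n n0 => // n _ /=.
  suff S (b b' : bool) (j : int) (g : {linear seg_term P b' (j + 1) -> Q}) : b -> ~~ b' ->
      (forall x, g (seg_step P b b' j x) = 0) -> forall x, g x = 0.
    by move=> g; apply: S; rewrite ?ltnn.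
  case: b => //; case: b' g => // g _ _ g0 x.
  by have [_ _ s] := cycle_ses j; have [y <-] := s x; apply: g0.
case=> [|k] kn g; first exact: seg_head_exact.
apply: iff_trans (seg_head_exact _ _ _) => //.
exact: seg_step_exact (ltnW kn) kn.
Qed.

End Segments.
End Cycles.

Section CompleteResolution.
Hypothesis kfg : kernels_fg A.
Hypothesis coGP : forall M : lmodType A, GP M ->
  exists (M' : lmodType A) (l : link M M'), GP M' /\ fgproj (mid l).

Lemma GP_complex M : GP M ->
  exists P : fgproj_acyclic_complex A, isomorphic M (cycle P 0).
Proof.
move=> gM; pose T := {N : lmodType A | GP N}.
have right (N : T) : exists N' : T, exists l : link (sval N) (sval N'), fgproj (mid l).
  case: N => N gN; have [N' [l [gN' fl]]] := coGP gN.
  by exists (exist _ N' gN'), l.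
have left (N : T) : exists N' : T, exists l : link (sval N') (sval N), fgproj (mid l).
  case: N => N gN; have [Q [q [fQ sq]]] := fg_cover gN.1.
  have gK : GP (kermod q) := GP_ker kfg (ses_ker sq) (GP_fgproj fQ.1 fQ.2) gN.
  by exists (exist _ (kermod q : lmodType A) gK), (Link (ses_ker sq)).
pose nr (N : T) : T := proj1_sig (constructive_indefinite_description _ (right N)).
have nrP (N : T) := proj2_sig (constructive_indefinite_description _ (right N)).
pose nl (N : T) : T := proj1_sig (constructive_indefinite_description _ (left N)).
have nlP (N : T) := proj2_sig (constructive_indefinite_description _ (left N)).
pose M0 : T := exist _ M gM.
(* [Negz k] stands for -(k + 1), whence the extra iteration. *)
pose Z (j : int) : lmodType A :=
  match j with Posz k => sval (iter k nr M0) | Negz k => sval (iter k.+1 nl M0) end.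
have ex (j : int) : exists l : link (Z j) (Z (j + 1)), fgproj (mid l).
  case: j => k.
    have -> : Posz k + 1 = Posz k.+1 by rewrite -addn1.
    exact: (nrP (iter k nr M0)).
  case: k => [|k]; first exact: (nlP M0).
  have -> : Negz k.+1 + 1 = Negz k by rewrite !NegzE -[k.+2]addn1 PoszD opprD addrNK.
  exact: (nlP (iter k.+1 nl M0)).
pose l j := proj1_sig (constructive_indefinite_description _ (ex j)).
have lP j : fgproj (mid (l j)) := proj2_sig (constructive_indefinite_description _ (ex j)).
by exists (linked_complex lP); apply: (linked_cycle lP 0).
Qed.

End CompleteResolution.
End Complexes.


(** * Cluster tilting subcategories *)

Section ClusterTilting.
Variables (A : nzRingType) (m : nat) (C : lmodType A -> Prop) (d : nat).
Local Notation n := m.+1.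
Local Notation Areg := (A^o : lmodType A).
Implicit Types (B D E F K M Q W X Y Z : lmodType A).
Hypothesis C_ct : nZ_cluster_tilting n C.
Hypothesis kfg : kernels_fg A.
Hypothesis injA : forall k X, (d <= k)%N -> ext k X Areg.
Hypothesis coGP : forall M : lmodType A, GP M ->
  exists (M' : lmodType A) (l : link M M'), GP M' /\ fgproj (mid l).

Lemma ct_fg X : C X -> fin_gen X.
Proof. by have [[_ c _] _] := C_ct => /c[]. Qed.

Lemma ct_ext k X Y : ~~ (n %| k.+1)%N -> C X -> C Y -> ext k X Y.
Proof. by have [_ c] := C_ct => nk CX CY; apply/Ext_vanishE; apply: c. Qed.

Lemma ndvd_small k : (k.+1 < n)%N -> ~~ (n %| k.+1)%N.
Proof. by move=> kn; rewrite gtnNdvd. Qed.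

Lemma ct_left X : fin_gen X ->
  (forall k Y, (k.+1 < n)%N -> C Y -> ext k X Y) -> C X.
Proof.
have [[_ _ c] _] := C_ct => fX eX; apply/c; split=> // -[//|k] Y kn CY.
by apply/Ext_vanishE; apply: eX.
Qed.

Lemma ct_right X : fin_gen X ->
  (forall k Y, (k.+1 < n)%N -> C Y -> ext k Y X) -> C X.
Proof.
have [[_ c _] _] := C_ct => fX eX; apply/c; split=> // -[//|k] Y kn CY.
by apply/Ext_vanishE; apply: eX.
Qed.

Lemma ct_bij X Y (f : {linear X -> Y}) : bijective f -> C Y -> C X.
Proof.
move=> bf CY; apply: ct_left => [|k Z kn CZ].
  exact: fin_gen_bijr bf (ct_fg CY).
exact: ext_bij bf (ct_ext (ndvd_small kn) CY CZ).
Qed.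

Lemma ct_fgproj Q : fgproj Q -> C Q.
Proof. by move=> [fQ pQ]; apply: ct_left => // k Y _ _; apply: ext_proj. Qed.

Lemma ct_ker_proj K B Q (i : {linear K -> B}) (p : {linear B -> Q}) :
  ses i p -> projective Q -> C B -> C K.
Proof.
move=> si pQ CB; apply: ct_left => [|k Y kn CY].
  exact: fin_gen_ses kfg si (ct_fg CB).
exact: ext_left si (ct_ext (ndvd_small kn) CB CY) (ext_proj _ _ pQ).
Qed.

Lemma ct_ext_proj K B Q (i : {linear K -> B}) (p : {linear B -> Q}) :
  ses i p -> fgproj Q -> C K -> C B.
Proof.
move=> si [fQ pQ] CK; apply: ct_left => [|k Y kn CY].
  exact: fin_gen_ext si (ct_fg CK) fQ.
exact: ext_mid si (ct_ext (ndvd_small kn) CK CY) (ext_proj _ _ pQ).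
Qed.

Lemma ct_approx X : fin_gen X -> exists D (p : {linear D -> X}),
  [/\ C D, surjective p & forall D' (g : {linear D' -> X}), C D' ->
      exists h : {linear D' -> D}, forall x, p (h x) = g x].
Proof.
move=> fX; have [[ff _ _] _] := C_ct.
have [[D [p [CD pP]]] _] := ff X fX; exists D, p; split=> //.
  have [Q [q [fQ sq]]] := fg_cover fX.
  have [h hE] := pP _ q (ct_fgproj fQ).
  by move=> x; have [y <-] := sq x; exists (h y).
by move=> D' g CD'; have [h hE] := pP _ g CD'; exists h => x; rewrite hE.
Qed.

(** Take right C-approximations repeatedly. The j-th kernel W has Ext^i(C, W) = 0 for 0 < i <= j:
    Ext^1 vanishes by the approximation property, and higher degrees come from the previous kernel.
    The kernel number n - 1 is therefore in C. The left end zero turns the resolution into a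
    chain. *)
Lemma ct_resolution X : fin_gen X -> exists c : chain n (zmod A) X, cterms C c.
Proof.
move=> fX.
suff [W [c [Pc fW eW]]] : exists W (c : chain m W X),
    [/\ cterms C c, fin_gen W & forall D i, C D -> (i < m)%N -> ext i D W].
  have CW : C W by apply: ct_right fW _ => k Y km CY; apply: eW.
  by exists (ccons (Link (ses_zmodl (@idfun_bij _ W))) c).
suff S j : (j <= m)%N -> exists W (c : chain j W X),
    [/\ cterms C c, fin_gen W & forall D i, C D -> (i < j)%N -> ext i D W].
  exact: S.
elim: j => [|j IH] jm; first by exists X, (cnil (@idfun_bij _ X)).
have [W [c [Pc fW eW]]] := IH (ltnW jm).
have [D [p [CD sp pP]]] := ct_approx fW.
have sk := ses_ker sp.
exists (kermod p), (ccons (Link sk) c); split=> //; first exact: kfg (ct_fg CD).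
move=> D' [|i] CD' ij.
  apply: (ext0_ker2 sk) => [|g]; last exact: pP.
  apply: (ct_ext (k := 0) _ CD' CD); apply: ndvd_small.
  by rewrite ltnS; apply: leq_ltn_trans jm.
apply: ext_left2 sk (eW _ _ CD' ij) _.
apply: ct_ext CD' CD; apply: ndvd_small; rewrite ltnS.
exact: (leq_ltn_trans (ij : (i.+1 <= j)%N) jm).
Qed.

(** Ext^(k+1)(D', Y) = Ext^(k+1+N)(D, Y), and n does not divide k + 1 + N when it divides N and 0 <
    k + 1 < n. *)
Lemma ct_syzygy (N : nat) D D' (c : chain N D' D) : (n %| N)%N ->
  cterms (@fgproj A) c -> C D -> C D'.
Proof.
move=> nN Pc CD; apply: ct_left => [|k Y kn CY].
  by apply: (chain_left_fg kfg (ct_fg CD)); apply: cterms_mono Pc => M [].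
have Pc' : cterms (@projective A) c by apply: cterms_mono Pc => M [].
apply: (chain_ext Pc'); apply: ct_ext => //.
by rewrite -addSn dvdn_addl // ndvd_small.
Qed.

Lemma GP_deep_syzygy N D D' (c : chain N D' D) :
  (d <= N)%N -> cterms (@fgproj A) c -> fin_gen D -> GP D'.
Proof.
move=> dN Pc fD; split=> [|k].
  by apply: (chain_left_fg kfg fD); apply: cterms_mono Pc => M [].
have Pc' : cterms (@projective A) c by apply: cterms_mono Pc => M [].
by apply: (chain_ext Pc'); apply: injA; apply: leq_trans dN (leq_addl _ _).
Qed.

Lemma cosyzygy_chain N K : GP K ->
  exists K' (c : chain N K K'), cterms (@fgproj A) c /\ GP K'.
Proof.
elim: N K => [|N IH] K gK; first by exists K, (cnil (@idfun_bij _ K)).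
have [M [l [gM fl]]] := coGP gK; have [K' [c [Pc gK']]] := IH M gM.
by exists K', (ccons l c).
Qed.

Lemma GP_ext_fgproj k M Q : GP M -> fgproj Q -> ext k M Q.
Proof. by move=> [_ eM] [fQ pQ]; apply: ext_fgproj. Qed.

Definition ctGP X : Prop := C X /\ GP X.

Lemma ctGP_fgproj Q : fgproj Q -> ctGP Q.
Proof. by move=> fQ; split; [apply: ct_fgproj | apply: GP_fgproj fQ.1 fQ.2]. Qed.

Lemma ctGP_bij X Y (f : {linear X -> Y}) : bijective f -> ctGP Y -> ctGP X.
Proof. by move=> bf [CY gY]; split; [apply: ct_bij CY | apply: GP_bij gY]; apply: bf. Qed.

Lemma ses_prod M (N : lmodType A) : exists i : {linear M -> (M * N)%type},
  ses i (snd : {linear (M * N)%type -> N}) /\ forall x, i x = (x, 0).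
Proof.
have l1 : linear (fun x : M => (x, 0) : (M * N)%type).
  by move=> a x y; apply: injective_projections; rewrite /= ?scaler0 ?addr0.
exists (mklin l1); split=> //; split.
- by move=> x y [].
- by move=> [x y]; split=> [/= ->|[z [_ <-]] //]; exists x.
- by move=> y; exists (0, y).
Qed.

Lemma ctGP_prod M Q : ctGP M -> fgproj Q -> ctGP (M * Q)%type.
Proof.
move=> [CM gM] fQ; have [i [si _]] := ses_prod M Q; split.
  exact: ct_ext_proj si fQ CM.
exact: GP_mid si gM (GP_fgproj fQ.1 fQ.2).
Qed.

Lemma ctGP_resolution K : GP K -> exists c : chain n (zmod A) K, cterms ctGP c.
Proof.
(* The number [d * n] is a multiple of n, so the syzygies stay in C, and it is at least d, so they
   are Gorenstein projective. *)
move=> gK; have [K' [t [Pt gK']]] := cosyzygy_chain (d * n) gK.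
have [c Pc] := ct_resolution gK'.1.
(* The left end of the resolution is zero and is given zero syzygies, so that the new chain starts
   at zero too. *)
have zt : exists t : chain (d * n) (zmod A) (zmod A), cterms (@fgproj A) t.
  elim: (d * n)%N => [|N [t' Pt']]; first by exists (cnil (@idfun_bij _ (zmod A))).
  exists (ccons (Link (ses_zmodl (@idfun_bij _ (zmod A)))) t'); split=> //.
  exact: fgproj_zmod.
have Pc2 : cterms (fun M => C M /\ fin_gen M) c.
  by apply: cterms_mono Pc => M CM; split=> //; apply: ct_fg.
have [c' Pc'] := resolve_syzygy kfg Pc2 zt (ex_intro _ t Pt).
exists c'; apply: cterms_mono Pc' => M [D [s [CD Ps]]]; split.
  exact: ct_syzygy (dvdn_mull d (dvdnn n)) Ps CD.
apply: GP_deep_syzygy Ps (ct_fg CD).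
by rewrite leq_pmulr.
Qed.

Lemma n_exact_chain X Y (c : chain n Y X) : C Y -> C X -> cterms C c ->
  n_exact n C (chain_seq c).
Proof.
move=> CY CX Pc; split.
- by move=> k _; apply: chain_seq_terms.
- exact: chain_seq_complex.
- move=> D CD; apply: (@chain_hom_from _ n) => // [i im|].
    by apply: ct_ext CD CY; apply: ndvd_small.
  by apply: cterms_mono Pc => B CB i im; apply: ct_ext CD CB; apply: ndvd_small.
- move=> D CD; apply: (@chain_hom_to _ n) => // [i im|].
    by apply: ct_ext CX CD; apply: ndvd_small.
  by apply: cterms_mono Pc => B CB i im; apply: ct_ext CB CD; apply: ndvd_small.
Qed.

Lemma ctGP_kernel X Y (f : {linear X -> Y}) : ctGP X -> ctGP Y -> surjective f ->
  exists S : mseq A,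
    [/\ n_exact n C S, forall k, (k <= n.+1)%N -> ctGP (S k)
      & exists (p : {linear S n -> X}) (q : {linear S n.+1 -> Y}),
          [/\ bijective p, bijective q & forall x, q (sd S n x) = f (p x)]].
Proof.
move=> cX cY sf.
(* The left end being zero, [B] is isomorphic to [W]. Dropping that zero leaves room for the term X
   within length n. *)
have [[W [[B i p s] c]] [/= PB Pc]] := ctGP_resolution (GP_ker kfg (ses_ker sf) cX.2 cY.2).
have cW : ctGP W.
  have [t [tK Kt]] := bij_linv (ses0_bij s (@zmodE A)).
  by apply: ctGP_bij PB; exists p; [apply: Kt | apply: tK].
pose l := Link (ses_ker sf).
have Pc' : cterms ctGP (crcons c l) by apply: cterms_crcons.
exists (chain_seq (crcons c l)); split.
- apply: n_exact_chain cW.1 cY.1 _; apply: cterms_mono Pc' => M [] //.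
- by move=> k _; apply: chain_seq_terms.
- have [u [bu uE]] := crcons_last c l.
  exists u, (last_map (crcons c l)); split=> //; exact: last_map_bij.
Qed.

Lemma ctGP_extension X Y : ctGP X -> ctGP Y -> forall E : extension n Y X,
  exists F : extension n Y X,
    [/\ n_exact n C F, forall k, (0 < k <= n)%N -> ctGP (F k)
      & yoneda_equiv E F].
Proof.
move=> cX cY E; have fX := ct_fg cX.1; have fY := ct_fg cY.1.
have [c [fc mcE]] := extension_chain E fY fX.
have [P [mPc fP gP]] := proj_extension c kfg cX.2 fY.
have [Z [Q [PQ gZ]]] := cosyzygy_chain n cY.2.
(* The class of E is thereby that of the pullback of [Q] along [g]. *)
have [g mg] : exists g, cmor P Q idfun g.
  apply: cmor_extend gP PQ => M T gM fT; exact: (GP_ext_fgproj 0 gM fT).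
have [F [q [fF sq]]] := fg_cover gZ.1.
pose p : {linear (X * F)%type -> Z} := (g \o fst) \+ (q \o snd).
have pE x : p x = g x.1 + q x.2 by [].
have sp : surjective p.
  by move=> z; have [x <-] := sq z; exists (0, x); rewrite pE linear0 add0r.
have cXF := ctGP_prod cX fF.
have [S PS] := ctGP_resolution (GP_ker kfg (ses_ker sp) cXF.2 gZ).
have [|Y' [R [j [q' [sj mR PR]]]]] := horseshoe S (ses_ker sp) (T := Q).
  by apply: cterms_mono PQ => M [].
have {}PR := PR _ _ _ ctGP_prod PS PQ.
(* The left end of [S] is zero, so the left end of the horseshoe is isomorphic to Y. *)
have bq := ses0_bij sj (@zmodE A); have [t [tK Kt]] := bij_linv bq.
have [|R' [mR' PR']] := chain_bijl R (f := t); first by exists q'.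
have {}PR' := PR' _ PR.
have [i [si iE]] := ses_prod X F; have [ii ip _] := si.
have [G [mG _ PG]] := pullback_chain R' i.
have {}PG : cterms ctGP G.
  apply: PG PR' _ _ => // M u su [CM gM].
  (* The pulled back term is the kernel of the composite of [u] with the projection to F. As F is
     projective, it inherits membership in C and Gorenstein projectivity from M. *)
  have sM : ses (pb_fst u i) (snd \o u).
    split=> [x y e|b|y].
    - by apply: pb_inj => //; apply: ii; rewrite -!pb_comm e.
    - rewrite [(_ \o _) b = 0]ip; split=> [[x xE]|[x <-]].
        by have [z [<- _]] := pb_elt (esym xE); exists z.
      by exists (pb_snd u i x); rewrite pb_comm.
    - by have [b bE] := su (0, y); exists b; rewrite /= bE.
  by split; [apply: ct_ker_proj sM fF.2 CM | apply: GP_ker kfg sM gM (GP_fgproj fF.1 fF.2)].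
have mGQ : cmor G Q idfun g.
  apply: cmor_eq (cmor_comp mG (cmor_comp mR' mR)) => x; first exact: Kt.
  by rewrite -[LHS]/(p (i x)) iE pE linear0 addr0.
(* Both [P] and [G] map to [Q] over [g], hence to its pullback [H] with identities at the ends. The
   equivalence is the zigzag E <- c <- P -> H <- G. *)
have [H [_ lft PH]] := pullback_chain Q g.
have fH : cterms (@fin_gen A) H.
  apply: PH PQ _ _ => [M [] //|M u _ [fM _]].
  by apply: kfg; apply: fin_gen_prod.
have fG : cterms (@fin_gen A) G by apply: cterms_mono PG => M [_ []].
exists (chain_extension fY fX fG); split.
- by apply: n_exact_chain cY.1 cX.1 _; apply: cterms_mono PG => M [].
- by move=> k _; apply: chain_seq_terms.
apply: rst_trans (rst_sym _ _ _ _ (rst_step _ _ _ _ mcE)) _.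
apply: rst_trans (rst_sym _ _ _ _ (rst_step _ _ _ _ (cmor_extension fY fY fX fX fP fc mPc))) _.
apply: rst_trans (rst_step _ _ _ _ (cmor_extension fY fY fX fX fP fH (lft _ _ _ mg))) _.
exact: rst_sym (rst_step _ _ _ _ (cmor_extension fY fY fX fX fG fH (lft _ _ _ mGQ))).
Qed.

(* Ext^(k+1)(Z^(a+n), Y) = Ext^(k+n+1)(Z^(a+n), K) = Ext^(k+1)(Z^a, K) for K the
   n-th syzygy of Y, which is again in C. *)
Lemma ct_cycle_up (P : fgproj_acyclic_complex A) a :
  C (cycle P a) -> C (cycle P (shift a n)).
Proof.
move=> Ca; apply: ct_left => [|k Y km CY]; first exact: fin_gen_cycle.
have gZ := GP_cycle P (shift a n) injA.
have [K [c Pc]] := @syzygy_chain A n Y kfg (ct_fg CY).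
have CK : C K := ct_syzygy (dvdnn n) Pc CY.
apply: (@chain_ext2 _ k _ _ _ c).
  by apply: cterms_mono Pc => Q fQ l; apply: GP_ext_fgproj.
by apply/(cycle_ext P k n); apply: ct_ext Ca CK; apply: ndvd_small.
Qed.

(** Z^a is an n-th syzygy of Z^(a+n), and shifting by n preserves non-divisibility of the degree by
    n. *)
Lemma ct_cycle_down (P : fgproj_acyclic_complex A) a :
  C (cycle P (shift a n)) -> C (cycle P a).
Proof.
move=> Ca; apply: ct_left => [|k Y km CY]; first exact: fin_gen_cycle.
apply/(cycle_ext P k n); apply: ct_ext => //.
by rewrite -addSn dvdn_addl // ndvd_small.
Qed.

Lemma ct_cycle (P : fgproj_acyclic_complex A) (i : int) :
  C (cycle P 0) -> C (cycle P (i * n%:Z)).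
Proof.
move=> C0; case: i => k; elim: k => [|k IH].
- by rewrite mul0r.
- have -> : Posz k.+1 * n%:Z = shift (Posz k * n%:Z) n.
    by rewrite shiftE intS mulrDl mul1r addrC.
  exact: ct_cycle_up.
- apply: ct_cycle_down; rewrite shiftE NegzE mulN1r addNr.
  exact: C0.
- apply: ct_cycle_down; have -> // : shift (Negz k.+1 * n%:Z) n = Negz k * n%:Z.
  rewrite shiftE !NegzE [k.+2%:Z]intS opprD mulrDl mulN1r.
  by rewrite addrC addrA subrr add0r.
Qed.

Lemma nZ_GprjE G : nZ_Gprj n C G <-> ctGP G.
Proof.
split=> [[CG [P [i [_ [f bf]]]]]|[CG gG]].
  by split=> //; apply: GP_bij bf (GP_cycle _ _ injA).
split=> //; have [P [f bf]] := GP_complex kfg coGP gG.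
exists P, 0; rewrite mul0r; split; last by exists f.
split=> [i Q pQ|i].
  apply: segment_hom_to_acyclic => // j g.
  (* Total acyclicity is tested on all projectives, including those that are not finitely generated,
     so [ext_fgproj] does not apply here. *)
  have eQ : ext0 (cycle P (j + 1)) Q.
    apply: ext0_projective kfg (fin_gen_cycle P _) pQ _.
    exact: (GP_cycle P (j + 1) injA).2 0%N.
  exact: eQ (cycle_ses P j) g.
apply: ct_cycle; have [h [hK Kh]] := bij_linv bf.
by apply: ct_bij CG; exists f; [apply: Kh | apply: hK].
Qed.

Lemma nZ_Gprj_n_resolving : n_resolving n C (nZ_Gprj n C).
Proof.
split=> [X []//|X fX pX|X Y f|X Y].
- exact/nZ_GprjE/ctGP_fgproj.
- move=> /nZ_GprjE cX /nZ_GprjE cY sf.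
  have [S [eS PS pq]] := ctGP_kernel cX cY sf.
  by exists S; split=> // k kn; apply/nZ_GprjE; apply: PS.
- move=> /nZ_GprjE cX /nZ_GprjE cY E.
  have [F [eF PF yF]] := ctGP_extension cX cY E.
  by exists F; split=> // k kn; apply/nZ_GprjE; apply: PF.
Qed.

End ClusterTilting.


(** * Application to Gorenstein artin algebras *)

Section ArtinAlgebra.
Variables (R : comPzRingType) (L : algType R).

Definition scalars (a : R) : L^c := a%:A.

Lemma scalars_zmod_morphism : zmod_morphism scalars.
Proof. by move=> a b; rewrite /scalars scalerBl. Qed.

Lemma scalars_monoid_morphism : monoid_morphism scalars.
Proof.
split; first exact: scale1r.
by move=> a b; rewrite /scalars -[RHS]/((b%:A : L) * a%:A) mulr_algl scalerA mulrC.
Qed.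

HB.instance Definition _ :=
  GRing.isZmodMorphism.Build R L^c scalars scalars_zmod_morphism.
HB.instance Definition _ :=
  GRing.isMonoidMorphism.Build R L^c scalars scalars_monoid_morphism.

Lemma scalars_central a (b : L^c) : scalars a * b = b * scalars a.
Proof. by rewrite -[LHS]/((b : L) * a%:A) -[RHS]/((a%:A : L) * b) mulr_algl mulr_algr. Qed.

Lemma fin_gen_restrict_scalars : fin_gen L ->
  fin_gen (restrict scalars (L^c^o : lmodType L^c)).
Proof.
move=> [k [e eP]]; exists k, e => x; have [c ->] := eP x; exists c.
apply: eq_bigr => i _; rewrite restrictE.
by rewrite -[RHS]/((e i : L) * (c i)%:A) mulr_algr.
Qed.

Hypothesis artL : artin_algebra L.

Lemma artin_algebra_kernels_fg : kernels_fg L^c.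
Proof.
move=> U V f; apply: (@fin_gen_ker _ _ scalars) artL.1 _ _ _ f.
exact: fin_gen_restrict_scalars artL.2.
Qed.

Hypothesis injL : finite_injdim (L^o : lmodType L).

(** The left approximation [j] by a free module is injective, since linear forms separate the points
    of M and all factor through [j]. Its cokernel has no Ext^1 to the algebra because forms on M
    extend along [j]; higher degrees follow by shifting. *)
Lemma GP_cosyzygy (M : lmodType L^c) : GP M ->
  exists (M' : lmodType L^c) (l : link M M'), GP M' /\ fgproj (mid l).
Proof.
move=> gM.
have [k [j jP]] := free_left_approx artL.1 (fin_gen_restrict_scalars artL.2)
  scalars_central gM.1.
have ij : injective j.
  apply: raddf_inj => x jx; apply: (GP_torsionless artin_algebra_kernels_fg injL gM).
  by move=> f; have [h <-] := jP f; rewrite jx linear0.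
have [W [p [ep sp]]] := cokernel_exists j.
have s : ses j p by [].
have fF : fgproj 'rV[L^c]_k.
  by split; [apply: fin_gen_row | apply: projective_row].
exists W, (Link s); split=> //; split; first exact: fin_gen_surj sp fF.1.
case=> [|i]; first by apply: ext0_ext s jP _; apply: ext0_proj fF.2.
exact: ext_right s (gM.2 i) (ext_proj _ _ fF.2).
Qed.

End ArtinAlgebra.

Theorem theorem4p6 (n : nat) (n_gt0 : (0 < n)%N)
    (R : comPzRingType) (L : algType R)
    (L_artin : artin_algebra L) (L_gor : gorenstein L)
    (C : lmodType L^c -> Prop) (C_ct : nZ_cluster_tilting n C) :
  n_resolving n C (nZ_Gprj n C).
Proof.
case: n n_gt0 C_ct => // m _ C_ct.
have [d injA] := finite_injdim_ext L_gor.1.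
apply: (nZ_Gprj_n_resolving C_ct) injA _.
  exact: artin_algebra_kernels_fg.
exact: GP_cosyzygy L_artin L_gor.2.
Qed.
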